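(* Let $G$ be a finitely generated group. Two minimal irreducible $\mathbb{R}$-trees $T_1$, $T_2$ with an isometric action of $G$ are compatible if and only if the sum $\ell=\ell_1+\ell_2$ of their length functions is a length function.
   Context: An $\mathbb{R}$-tree is a geodesic metric space in which any two distinct points are connected by a unique topological arc; all $\mathbb{R}$-trees carry an isometric action of $G$. The action is minimal if there is no proper $G$-invariant subtree. For $g\in G$, $\ell_T(g)=\min_{x\in T}d(x,gx)$ is its translation length (the minimum is attained); $g$ is hyperbolic if $\ell_T(g)>0$, in which case it has an axis, an invariant line on which it translates. The map $\ell_T:G\to\mathbb{R}$ is the length function of $T$. A map $\ell:G\to\mathbb{R}$ is a length function if there is an $\mathbb{R}$-tree $T$ with an isometric action of $G$ such that $\ell=\ell_T$. $T$ is irreducible if there are two hyperbolic elements $g,h\in G$ whose axes have intersection of finite length (possibly empty). A map $f:T\to T'$ preserves alignment (is a collapse map) if the image of any segment $[a,b]$ is the segment $[f(a),f(b)]$ (possibly a point). Two $\mathbb{R}$-trees $T_1,T_2$ are compatible if there exist an $\mathbb{R}$-tree $\hat T$ with an isometric action of $G$ and $G$-equivariant maps $\hat T\to T_1$ and $\hat T\to T_2$ preserving alignment. *)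

(* Defs.v *)
(* Isometric actions of a group on R-trees, following the conventions of
   MathComp-Analysis: [R : realType] is the real line and metric spaces are
   [metricType R] with distance [mdist].  *)
From mathcomp Require Import all_boot all_order all_algebra.
From mathcomp Require Import all_classical all_reals all_analysis.

Set Implicit Arguments.
Unset Strict Implicit.
Unset Printing Implicit Defensive.

Import Order.TTheory GRing.Theory Num.Theory.
Import numFieldNormedType.Exports.

Local Open Scope classical_set_scope.
Local Open Scope ring_scope.

Definition finitely_generated (G : groupType) : Prop :=
  exists s : seq G, forall H : {pred G},
    group_closed H -> {subset s <= H} -> forall g : G, g \in H.

Section MetricSpaces.
Context {R : realType}.

Definition geodesic_path {T : metricType R} (x y : T) (c : R -> T) : Prop :=
  [/\ c 0 = x, c (mdist x y) = y &
      {in `[0, mdist x y] &, forall s t, mdist (c s) (c t) = `|s - t|}].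

Definition geodesic_space (T : metricType R) : Prop :=
  forall x y : T, exists c, geodesic_path x y c.

(* [A] is the image of a homeomorphism from [0, 1] onto [A] mapping 0 to [x]
   and 1 to [y]; [p] is its inverse.  *)
Definition is_arc {T : metricType R} (x y : T) (A : set T) : Prop :=
  exists (c : R -> T) (p : T -> R),
    [/\ c 0 = x /\ c 1 = y,
        A = c @` `[0, 1],
        {within `[0, 1], continuous c},
        {within A, continuous p} &
        {in `[0, 1], cancel c p}].

(* Without nonemptiness, the empty space would have (equivariant, alignment
   preserving) maps to every tree.  *)
Definition is_Rtree (T : metricType R) : Prop :=
  [/\ [set: T] !=set0,
      geodesic_space T &
      forall x y : T, x <> y -> exists! A : set T, is_arc x y A].

(* The union of all geodesics from [a] to [b]; in an R-tree there is only one,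
   which is the unique arc from [a] to [b] when a <> b, and {a} when a = b.  *)
Definition segment {T : metricType R} (a b : T) : set T :=
  [set z | exists2 c, geodesic_path a b c & (c @` `[0, mdist a b]) z].

Definition preserves_alignment {T T' : metricType R} (f : T -> T') : Prop :=
  forall a b : T, f @` segment a b = segment (f a) (f b).

Definition subtree {T : metricType R} (S : set T) : Prop :=
  S !=set0 /\ forall a b : T, S a -> S b -> segment a b `<=` S.

(* Meant for convex subsets of a line, whose length is their diameter; the
   empty set qualifies.  *)
Definition finite_length {T : metricType R} (S : set T) : Prop :=
  exists M : R, forall x y : T, S x -> S y -> mdist x y <= M.

End MetricSpaces.

Record Gtree (R : realType) (G : groupType) := {
  gtree_space :> metricType R;
  gact : G -> gtree_space -> gtree_space;
  gtree_Rtree : is_Rtree gtree_space;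
  gact1 : forall x, gact 1%g x = x;
  gactM : forall g h x, gact (g * h)%g x = gact g (gact h x);
  gact_isometry : forall g x y, mdist (gact g x) (gact g y) = mdist x y }.

Section GTrees.
Context {R : realType} {G : groupType}.
Implicit Types (T : Gtree R G) (g h : G).

Definition minimal_action T : Prop :=
  forall S : set T, subtree S -> (forall g x, S x -> S (gact g x)) ->
    S = [set: T].

(* This infimum is a minimum for every action on an R-tree.  *)
Definition translation_length T g : R :=
  inf [set mdist x (gact g x) | x in [set: T]].

Definition hyperbolic T g : Prop := 0 < translation_length T g.

(* [A] is a line (an isometric copy of R) on which [g] acts as the translation
   by its translation length.  *)
Definition is_axis T g (A : set T) : Prop :=
  exists c : R -> T,
    [/\ forall s t, mdist (c s) (c t) = `|s - t|,
        A = range c &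
        forall t, gact g (c t) = c (t + translation_length T g)].

Definition irreducible_action T : Prop :=
  exists g h, [/\ hyperbolic T g, hyperbolic T h &
    exists A B : set T,
      [/\ is_axis g A, is_axis h B & finite_length (A `&` B)]].

Definition length_function (l : G -> R) : Prop :=
  exists T, l =1 translation_length T.

Definition equivariant T T' (f : T -> T') : Prop :=
  forall g x, f (gact g x) = gact g (f x).

Definition compatible T1 T2 : Prop :=
  exists (T : Gtree R G) (f1 : T -> T1) (f2 : T -> T2),
    [/\ equivariant f1, preserves_alignment f1,
        equivariant f2 & preserves_alignment f2].

End GTrees.

(* Main.v *)
(** If T1 and T2 have a common refinement, its image in T1 * T2 with the l1
    metric is an R-tree, and since l(g) = lim d(x, g^n x) / n the translation
    lengths add up.

    Conversely let l1 + l2 = l_T.  Irreducibility gives u and v, hyperbolic in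
    T1 and T2, whose axes are disjoint in both trees; then
    l_T(uv) > l_T(u) + l_T(v), so they are disjoint in T as well.  The foot p of
    the bridge between the axes is the center of a tripod whose legs end on the
    axes of v, u v u^-1 and u^-1 v u.  Between a leg of this tripod and a leg of
    its translate by g, the length of a bridge, which is an expression in
    translation lengths, equals d(p, gp) plus constants for all but few of the
    nine choices, so that one choice serves T1 and T2 at once and
    d_T(p, gp) = d_1(p1, gp1) + d_2(p2, gp2).

    By the four-point conditions for d_1, d_2 and their sum, the branch points
    of each segment [gp, hp] of T occur in the same order in T1 and T2.
    Interpolating between branch points embeds the convex hull of Gp
    isometrically and equivariantly in T1 * T2 with the l1 metric; the image is
    an R-tree on which both projections preserve alignment. *)
From HB Require Import structures.
Require Import Defs.
From mathcomp Require Import all_boot all_order all_algebra.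
From mathcomp Require Import all_classical all_reals all_analysis.
From mathcomp Require Import lra.

Set Implicit Arguments.
Unset Strict Implicit.
Unset Printing Implicit Defensive.

Import Order.TTheory GRing.Theory Num.Theory.
Import numFieldNormedType.Exports.

Local Open Scope classical_set_scope.
Local Open Scope ring_scope.

(** * Betweenness and geodesics *)

(** The tree of the sum is known only through its length function, so at first nothing relates its
    points to those of [T1] and [T2]. The base points supply the relation: once their displacements
    add up for every group element, so do all distances between orbit points, and the three trees
    can be compared through Gromov products of orbit points. Three legs are what the count needs: in
    a given tree at most one leg of a tripod heads for the other tripod, so two trees spoil at most
    two of the three choices at either end. Branch points come in the same order because, in a tree,
    the least of three Gromov products at a point is attained twice; two branch points in opposite
    orders would give the sum a least value attained only once. Between branch points nothing
    prescribes how length is shared between [T1] and [T2]. The sharing must depend neither on the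
    orientation nor on the segment chosen through a point, or it would not define an equivariant
    map. *)

Section Continuity.
Context {R : realType} {T : metricType R}.

Lemma nbhs_mdist_ball (x : T) (e : R) : 0 < e -> \forall y \near x, mdist x y < e.
Proof.
move=> e0; have := nbhsx_ballx x _ e0.
by rewrite ballEmdist.
Qed.

Lemma nbhs_mdistE (x : T) (P : set T) :
  nbhs x P -> exists2 e : R, 0 < e & forall y, mdist x y < e -> P y.
Proof.
rewrite -nbhs_ballE => -[e /= e0 eP]; exists e => // y xy.
by apply: eP; rewrite ballEmdist.
Qed.

Lemma within_continuous_path (A : set R) (c : R -> T) :
  {within A, continuous c} <->
  forall s, A s -> forall e, 0 < e -> exists2 d, 0 < d &
    forall t, A t -> `|s - t| < d -> mdist (c s) (c t) < e.
Proof.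
split=> [/subspace_continuousP cc s As e e0|cc].
  have /= := cc s As _ (nbhs_mdist_ball (c s) e0).
  rewrite /within /= /nbhs/= /fmap/=.
  move=> [d /= d0 dP]; exists d => // t At st; exact: (dP t st At).
apply/subspace_continuousP => s As P /nbhs_mdistE [e e0 eP].
have [d d0 dP] := cc s As e e0.
by exists d => //= t st At; apply: eP; exact: dP.
Qed.

Lemma within_continuous_fun (A : set T) (p : T -> R) :
  (forall x, A x -> forall e, 0 < e -> exists2 d, 0 < d &
    forall y, A y -> mdist x y < d -> `|p x - p y| < e) ->
  {within A, continuous p}.
Proof.
move=> cc; apply/subspace_continuousP => s As P [e /= e0 eP].
have [d d0 dP] := cc s As e e0.
rewrite /within/= /fmap/= /nbhs/=.
have := nbhs_mdist_ball s d0; apply: filterS => t st At; apply: eP => /=.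
exact: dP.
Qed.

End Continuity.

Section Betweenness.
Context {R : realType} {T : metricType R}.
Implicit Types x y z w m : T.

(** Betweenness by distances alone turns most arguments on trees into linear arithmetic; [segmentE]
    ties it to [segment]. *)
Definition btw x m y : Prop := mdist x m + mdist m y = mdist x y.

Lemma btw_sym x m y : btw x m y -> btw y m x.
Proof.
by rewrite /btw (metric_sym y m) (metric_sym m x) (metric_sym y x) => <-; rewrite addrC.
Qed.

Lemma btwxx x y : btw x x y.
Proof. by rewrite /btw mdistxx add0r. Qed.

Lemma btwyy x y : btw x y y.
Proof. by rewrite /btw mdistxx addr0. Qed.

Lemma btw_le x m y : mdist x m + mdist m y <= mdist x y -> btw x m y.
Proof.
by move=> h; apply/eqP; rewrite eq_le h metric_triangle.
Qed.

Lemma btw_trans x n m y : btw x m y -> btw x n m -> btw x n y.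
Proof.
rewrite /btw => h1 h2; apply: btw_le.
have := metric_triangle n m y; lra.
Qed.

Lemma btw_transr x n m y : btw x m y -> btw x n m -> btw n m y.
Proof.
rewrite /btw => h1 h2; apply: btw_le.
have := metric_triangle x n y; lra.
Qed.

Lemma mdist_lip x y z : `|mdist z x - mdist z y| <= mdist x y.
Proof.
rewrite ler_norml; have := metric_triangle z x y; have := metric_triangle z y x.
by rewrite (metric_sym y x) => ? ?; apply/andP; split; lra.
Qed.

(** Gromov's 0-hyperbolicity: of the three sums of opposite distances, the two largest are equal.
    The disjunction avoids a maximum, so that case analysis leaves linear goals. *)
Definition fourpt (X : metricType R) : Prop := forall x y z w : X,
  mdist x y + mdist z w <= mdist x z + mdist y w \/
  mdist x y + mdist z w <= mdist x w + mdist y z.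

Lemma geodesic_pathE x y (c : R -> T) s : geodesic_path x y c ->
  0 <= s <= mdist x y -> mdist x (c s) = s /\ mdist (c s) y = mdist x y - s.
Proof.
move=> [c0 c1 ci] sl; have s0 : s \in `[0, mdist x y] by rewrite in_itv.
have l0 : (0 : R) \in `[0, mdist x y] by rewrite in_itv /= lexx mdist_ge0.
have l1 : mdist x y \in `[0, mdist x y] by rewrite in_itv /= lexx mdist_ge0.
split; first by rewrite -{1}c0 ci// sub0r normrN ger0_norm//; case/andP: sl.
by rewrite -{1}c1 ci// distrC ger0_norm// subr_ge0; case/andP: sl.
Qed.

Lemma geodesic_path_btw x y (c : R -> T) s : geodesic_path x y c ->
  0 <= s <= mdist x y -> btw x (c s) y.
Proof.
by move=> gc sl; have [h1 h2] := geodesic_pathE gc sl; rewrite /btw h1 h2; lra.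
Qed.

Lemma isometry_continuous (A : set R) (c : R -> T) :
  (forall s t, A s -> A t -> mdist (c s) (c t) = `|s - t|) ->
  {within A, continuous c}.
Proof.
move=> ci; apply/within_continuous_path => s As e e0; exists e => // t At.
by rewrite ci.
Qed.

Lemma geodesic_concat x m y : btw x m y -> geodesic_space T ->
  exists2 c, geodesic_path x y c & c (mdist x m) = m.
Proof.
move=> xmy gT; have [c1 g1] := gT x m; have [c2 g2] := gT m y.
have [a0 a1 ai] := g1; have [b0 b1 bi] := g2.
have p0 := mdist_ge0 x m; have q0 := mdist_ge0 m y.
pose c t := if t <= mdist x m then c1 t else c2 (t - mdist x m).
have cm : c (mdist x m) = m by rewrite /c lexx.
have c0 : c 0 = x by rewrite /c p0.
have cy : c (mdist x y) = y.
  rewrite /c; case: ifPn => [h|_]; last by rewrite -xmy addrC addKr.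
  have q : mdist m y = 0 by move: xmy; rewrite /btw; lra.
  have e : mdist x y = mdist x m by rewrite -xmy q addr0.
  by rewrite e a1; exact: mdist_positivity q.
exists c => //; split => //.
have lt s t : 0 <= s -> s <= t -> t <= mdist x y -> mdist (c s) (c t) = t - s.
  move=> s0 st tl; rewrite /c.
  case: (leP s (mdist x m)) => sm; case: (leP t (mdist x m)) => tm.
  - rewrite ai ?in_itv /=; last 2 first.
      by rewrite s0.
      by rewrite tm andbT; lra.
    by rewrite distrC ger0_norm // subr_ge0.
  - have /(geodesic_pathE g1) [e1 e2] : 0 <= s <= mdist x m by rewrite s0.
    have /(geodesic_pathE g2) [e3 e4] : 0 <= t - mdist x m <= mdist m y.
      by move: xmy; rewrite /btw => xmy; apply/andP; split; lra.
    move: xmy e1 e2 e3 e4; rewrite /btw.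
    move: (c1 s) (c2 _) => u v h e1 e2 e3 e4.
    have := metric_triangle u m v; have := metric_triangle x u y.
    have := metric_triangle u v y; lra.
  - lra.
  - rewrite bi ?in_itv /=; last 2 first.
    + by move: xmy; rewrite /btw => xmy; apply/andP; split; lra.
    + by move: xmy; rewrite /btw => xmy; apply/andP; split; lra.
    rewrite distrC ger0_norm; lra.
move=> s t; rewrite !in_itv /= => /andP[s0 s1] /andP[t0 t1].
have [st|ts] := leP s t.
  by rewrite lt// distrC ger0_norm// subr_ge0.
by rewrite metric_sym lt ?(ltW ts)// ger0_norm// subr_ge0 ltW.
Qed.

Lemma segmentE : geodesic_space T ->
  forall a b z, segment a b z <-> btw a z b.
Proof.
move=> gT a b z; split=> [[c gc [s /=]]|azb].
  by rewrite in_itv /= => sl <-; exact: (geodesic_path_btw gc).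
have [c gc cz] := geodesic_concat azb gT.
exists c => //; exists (mdist a z) => //=; rewrite in_itv /= mdist_ge0 /=.
by rewrite -azb lerDl mdist_ge0.
Qed.

Lemma geodesic_arc x y c : x <> y -> geodesic_path x y c ->
  is_arc x y (c @` `[0, mdist x y]).
Proof.
move=> xy gc; have [c0 c1 ci] := gc.
have L0 : 0 < mdist x y by rewrite mdist_gt0; apply/eqP.
have Ln : mdist x y != 0 by rewrite gt_eqF.
exists (fun u => c (u * mdist x y)), (fun w => mdist x w / mdist x y).
have sc u : 0 <= u <= 1 -> 0 <= u * mdist x y <= mdist x y.
  by move=> /andP[u0 u1]; rewrite mulr_ge0 ?mdist_ge0//= ler_piMl ?mdist_ge0.
split.
- by rewrite mul0r mul1r.
- apply/seteqP; split=> w /= [s]; rewrite in_itv /= => /andP[s0 s1] <-.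
    exists (s / mdist x y); last by rewrite divfK.
    rewrite in_itv /= divr_ge0 ?mdist_ge0//=.
    by rewrite ler_pdivrMr// mul1r.
  by exists (s * mdist x y) => //=; rewrite in_itv /= sc// s0.
- apply/within_continuous_path => s /=; rewrite in_itv /= => s01 e e0.
  exists (e / mdist x y); first by rewrite divr_gt0.
  move=> t /=; rewrite in_itv /= => t01 st.
  rewrite ci ?in_itv ?sc// -mulrBl normrM (ger0_norm (mdist_ge0 x y)).
  by rewrite -ltr_pdivlMr.
- apply: within_continuous_fun => z _ e e0.
  exists (e * mdist x y); first by rewrite mulr_gt0.
  move=> w _ zw; rewrite -mulrBl normrM normfV (ger0_norm (mdist_ge0 x y)).
  by rewrite ltr_pdivrMr// (le_lt_trans (mdist_lip z w x)).
- move=> u; rewrite in_itv /= => u01.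
  by have [-> _] := geodesic_pathE gc (sc _ u01); rewrite mulfK.
Qed.

End Betweenness.

(** * R-trees and the four-point condition *)

Section FourPoint.
Context {R : realType} {T : metricType R}.
Hypothesis T4 : fourpt T.
Implicit Types a b x y z w m : T.

(** Removing [m] separates [a] from [b], so [w] is cut off from at least one of them. *)
Lemma btw_or a m b w : btw a m b -> btw a m w \/ btw b m w.
Proof.
move=> h; have := T4 a b w m; rewrite /btw in h.
rewrite (metric_sym b m) (metric_sym w m) => -[h1|h1].
  by left; apply: btw_le; lra.
by right; apply: btw_le; rewrite (metric_sym b m); lra.
Qed.

Lemma btw_uniq a b m n : btw a m b -> btw a n b -> mdist a m = mdist a n -> m = n.
Proof.
rewrite /btw => h1 h2 h; apply: mdist_positivity; apply/eqP.
rewrite eq_le mdist_ge0 andbT.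
have := T4 a b m n; rewrite (metric_sym b n) (metric_sym b m) => -[]; lra.
Qed.

(** In a tree local geodesics are geodesics. The overlap [[m, n]] must be nondegenerate: for [m = n]
    both hypotheses are trivial. *)
Lemma btw_chain a m n b : btw a m n -> btw m n b -> m <> n ->
  btw a m b /\ btw a n b.
Proof.
move=> h1 h2 /eqP; rewrite -mdist_gt0 => mn; rewrite /btw in h1 h2.
have := T4 a n m b; rewrite (metric_sym n m).
have := metric_triangle a n b; have := metric_triangle a m b.
by split; apply: btw_le; lra.
Qed.

Lemma btw_dist a m b w : btw a m b ->
  mdist m w <= Num.max (mdist a w - mdist a m) (mdist b w - mdist b m).
Proof.
move=> h; case: (btw_or w h) => <-; rewrite le_max.
  by apply/orP; left; lra.
by apply/orP; right; lra.
Qed.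

Hypothesis Tg : geodesic_space T.

Lemma btw_point a b s : 0 <= s <= mdist a b ->
  exists2 m, btw a m b & mdist a m = s.
Proof.
move=> sl; have [c gc] := Tg a b.
by exists (c s); [exact: geodesic_path_btw gc sl|case: (geodesic_pathE gc sl)].
Qed.

Lemma median x y z : exists m, [/\ btw x m y, btw x m z & btw y m z].
Proof.
have t1 := metric_triangle x y z; have t2 := metric_triangle x z y.
have t3 := metric_triangle y x z.
(* The Gromov product of [y] and [z] at [x], the length that [[x, y]] and [[x, z]] share. *)
pose s := (mdist x y + mdist x z - mdist y z) / 2.
move: t1 t2 t3; rewrite (metric_sym z y) (metric_sym y x) => t1 t2 t3.
have [|m xmy dm] := @btw_point x y s.
  by rewrite /s; apply/andP; split; lra.
have xym := xmy; rewrite /btw in xym; rewrite /s in dm.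
exists m; split=> //; apply: btw_le.
  have := T4 x y z m; rewrite (metric_sym z m) (metric_sym y m) => -[]; lra.
have := T4 x y z m; rewrite (metric_sym z m) (metric_sym y m) => -[]; lra.
Qed.

(* The signed distance to [m], positive on the far side of [m] from [a], is
   1-Lipschitz, so a path from [a] to [b] that avoids [m] would contradict the
   intermediate value theorem. *)
Lemma path_through (c : R -> T) s t m : s <= t -> {within `[s, t], continuous c} ->
  btw (c s) m (c t) -> exists2 u, s <= u <= t & c u = m.
Proof.
move=> st cc smt; have [sm|sm] := eqVneq (c s) m.
  by exists s => //; rewrite lexx.
pose h w := if `[< btw (c s) m w >] then mdist m w else - mdist m w.
have hfar w w' : btw (c s) m w -> ~ btw (c s) m w' ->
    `|mdist m w - - mdist m w'| <= mdist w w'.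
  move=> h1 h2; have [//|h3] := btw_or w' h1.
  rewrite opprK ger0_norm ?addr_ge0 ?mdist_ge0//.
  by rewrite (metric_sym m w) h3.
have hl w w' : `|h w - h w'| <= mdist w w'.
  rewrite /h; case: asboolP => h1; case: asboolP => h2.
  - exact: mdist_lip.
  - exact: hfar.
  - by have := hfar _ _ h2 h1; rewrite (metric_sym w') distrC.
  - by rewrite -opprD normrN; exact: mdist_lip.
have [||u ust hu] := @IVT R (h \o c) s t 0 st.
- apply/(@within_continuous_path R R^o) => x xs e e0.
  have [d d0 dP] := (within_continuous_path _ _).1 cc _ xs _ e0.
  exists d => // y ys xy; rewrite /mdist /= distrC.
  by rewrite (le_lt_trans (hl _ _))// dP.
- have hs : h (c s) <= 0.
    rewrite /h; case: asboolP => [|_]; last by rewrite oppr_le0 mdist_ge0.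
    rewrite /btw mdistxx (metric_sym m) => /eqP; rewrite -mulr2n mulrn_eq0/=.
    by move=> /eqP->.
  have ht : 0 <= h (c t) by rewrite /h; case: asboolP => // _; rewrite mdist_ge0.
  by rewrite /= ge_min hs /= le_max ht orbT.
exists u; first by move: ust; rewrite in_itv.
apply/esym/mdist_positivity; move: hu; rewrite /= /h; case: asboolP => // _.
by move=> /eqP; rewrite oppr_eq0 => /eqP.
Qed.

(** By [path_through] the arc covers the segment. Conversely, the median of [x], [y] and [c s] is
    met both before and after time [s]; as [c] is injective, it is [c s]. *)
Lemma arc_btw x y (A : set T) : is_arc x y A -> A = [set z | btw x z y].
Proof.
move=> [c [p [[c0 c1] Ae cc _ cp]]].
have sub s t : 0 <= s -> t <= 1 -> {within `[s, t], continuous c}.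
  move=> s0 t1; apply: continuous_subspaceW cc => u /=; rewrite !in_itv /=.
  by move=> /andP[h1 h2]; rewrite (le_trans s0)//= (le_trans h2).
have inA u : 0 <= u <= 1 -> A (c u).
  by move=> u01; rewrite Ae; exists u => //=; rewrite in_itv.
apply/seteqP; split=> z /=.
  rewrite Ae => -[s /=]; rewrite in_itv /= => /andP[s0 s1] <- {z}.
  have [m [h1 h2 h3]] := median x y (c s).
  have [||u us um] := @path_through c 0 s m s0.
  - exact: sub.
  - by rewrite c0.
  have [||v vs vm] := @path_through c s 1 m s1.
  - exact: sub.
  - by rewrite c1; exact: btw_sym.
  have uv : u = v.
    rewrite -(cp u) ?um -?vm ?cp// in_itv /=.
      by case/andP: vs => h4 ->; rewrite (le_trans s0).
    by case/andP: us => -> h4; rewrite (le_trans h4).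
  have -> : s = u.
    apply/eqP; rewrite eq_le; move: us vs; rewrite -uv.
    by move=> /andP[_ ->] /andP[-> _].
  by rewrite um.
move=> xzy; have [||u us um] := @path_through c 0 1 z ler01.
- exact: sub.
- by rewrite c0 c1.
by rewrite -um; exact: inA.
Qed.

Lemma fourpt_Rtree : [set: T] !=set0 -> is_Rtree T.
Proof.
move=> T0; split => // x y xy; have [c gc] := Tg x y.
exists (c @` `[0, mdist x y]); split; first exact: geodesic_arc.
move=> A arcA; rewrite (arc_btw (geodesic_arc xy gc)).
by rewrite (arc_btw arcA).
Qed.

End FourPoint.

(** * Gluing two geodesics into an arc *)

Section Arcs.
Context {R : realType} {T : metricType R}.
Implicit Types a b x y z w m : T.

Lemma isometric_image_closed (K : R) (c : R -> T) :
  (forall s t : R, 0 <= s <= K -> 0 <= t <= K -> mdist (c s) (c t) = `|s - t|) ->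
  closed (c @` `[0, K]).
Proof.
move=> ci; apply: (compact_closed (@metric_hausdorff _ T)).
apply: continuous_compact (@segment_compact _ 0 K).
by apply: isometry_continuous => s t /=; rewrite !in_itv /=; exact: ci.
Qed.

(** Two geodesics from [m] that meet only there form an arc, run through by [g] over [[-K1, K2]]. It
    need not be known to be geodesic, which is what lets uniqueness of arcs say something in
    [Rtree_median]. *)
Lemma join_arc m (K1 K2 : R) (a1 a2 : R -> T) :
  0 <= K1 -> 0 <= K2 -> 0 < K1 + K2 -> a1 0 = m -> a2 0 = m ->
  (forall s t : R, 0 <= s <= K1 -> 0 <= t <= K1 -> mdist (a1 s) (a1 t) = `|s - t|) ->
  (forall s t : R, 0 <= s <= K2 -> 0 <= t <= K2 -> mdist (a2 s) (a2 t) = `|s - t|) ->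
  (forall s t : R, 0 <= s <= K1 -> 0 <= t <= K2 -> a1 s = a2 t -> a1 s = m) ->
  is_arc (a1 K1) (a2 K2) (a1 @` `[0, K1] `|` a2 @` `[0, K2]).
Proof.
move=> K10 K20 K0 a10 a20 i1 i2 i12.
have Kn : K1 + K2 != 0 by rewrite gt_eqF.
pose A1 := a1 @` `[0, K1]; pose A2 := a2 @` `[0, K2].
have dm1 (s : R) : 0 <= s <= K1 -> mdist m (a1 s) = s.
  move=> /andP[s0 s1]; rewrite -a10 i1 ?lexx ?s0//.
  by rewrite sub0r normrN ger0_norm.
have dm2 (s : R) : 0 <= s <= K2 -> mdist m (a2 s) = s.
  move=> /andP[s0 s1]; rewrite -a20 i2 ?lexx ?s0//.
  by rewrite sub0r normrN ger0_norm.
pose g (v : R) := if v <= 0 then a1 (- v) else a2 v.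
have gl (v w : R) : - K1 <= v -> v <= w -> w <= K2 -> mdist (g v) (g w) <= w - v.
  move=> v0 vw w1; rewrite /g; case: (leP v 0) => hv; case: (leP w 0) => hw.
  - rewrite i1; [|by apply/andP; split; lra..].
    by rewrite ler_norml; apply/andP; split; lra.
  - have := metric_triangle (a1 (- v)) m (a2 w).
    rewrite (metric_sym _ m) dm1 ?dm2; first [lra | by apply/andP; split; lra].
  - lra.
  - rewrite i2; [|by apply/andP; split; lra..].
    by rewrite ler_norml; apply/andP; split; lra.
(* The inverse of [g] is a signed distance to [m]; it is continuous on each of the two closed
   pieces, hence on their union. *)
pose q w := if `[< A1 w >] then - mdist m w else mdist m w.
have q2 (t : R) : 0 <= t <= K2 -> q (a2 t) = t.
  move=> t01; rewrite /q; case: asboolP => [[s /=]|_]; last exact: dm2.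
  rewrite in_itv /= => s01 st; have := i12 s t s01 t01 st.
  by rewrite st => e; rewrite -[RHS]dm2// e mdistxx oppr0.
have q1 (s : R) : 0 <= s <= K1 -> q (a1 s) = - s.
  move=> s01; rewrite /q; case: asboolP => [_|h]; first by rewrite dm1.
  by exfalso; apply: h; exists s => //=; rewrite in_itv.
have qg (v : R) : - K1 <= v <= K2 -> q (g v) = v.
  move=> /andP[h1 h2]; rewrite /g; case: (leP v 0) => hv.
    rewrite q1 ?opprK//; apply/andP; split; lra.
  by rewrite q2// ltW.
have inK (u : R) : 0 <= u <= 1 -> - K1 <= u * (K1 + K2) - K1 <= K2.
  move=> /andP[u0 u1]; have : 0 <= u * (K1 + K2) by rewrite mulr_ge0// ltW.
  have : u * (K1 + K2) <= K1 + K2 by rewrite ler_piMl// ltW.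
  by move=> ? ?; apply/andP; split; lra.
exists (fun u : R => g (u * (K1 + K2) - K1)), (fun w => (q w + K1) / (K1 + K2)).
split.
- rewrite mul0r mul1r sub0r [K1 + K2]addrC addrK /g oppr_le0 K10 opprK; split=> //.
  case: (leP K2 0) => h //; have -> : K2 = 0 by apply/eqP; rewrite eq_le h K20.
  by rewrite oppr0 a10 a20.
- apply/seteqP; split=> w /=.
    have H (v : R) : - K1 <= v <= K2 -> exists2 x, x \in `[0, 1] & 
        g (x * (K1 + K2) - K1) = g v.
      move=> /andP[h1 h2]; exists ((v + K1) / (K1 + K2)).
        rewrite in_itv /=; apply/andP; split.
          by apply: divr_ge0 (ltW K0); lra.
        by rewrite ler_pdivrMr// mul1r; lra.
      by rewrite divfK// addrK.
    move=> [[s /=]|[s /=]]; rewrite in_itv /= => /andP[s0 s1] <-.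
      have [|u u01 e] := H (- s); first by apply/andP; split; lra.
      exists u => //=; rewrite e /g oppr_le0 s0 opprK//.
    have [|u u01 e] := H s; first by apply/andP; split; lra.
    exists u => //=; rewrite e /g; case: (leP s 0) => // h.
    have -> : s = 0 by apply/eqP; rewrite eq_le h s0.
    by rewrite oppr0 a10 a20.
  move=> [u]; rewrite in_itv /= => /inK; move: (_ - K1) => v /andP[v0 v1] <-.
  rewrite /g; case: (leP v 0) => hv.
    by left; exists (- v) => //=; rewrite in_itv /=; apply/andP; split; lra.
  by right; exists v => //=; rewrite in_itv /= v1 ltW.
- apply/within_continuous_path => s /=; rewrite in_itv /= => s01 e e0.
  exists (e / (K1 + K2)); first by rewrite divr_gt0.
  move=> t /=; rewrite in_itv /= => t01; rewrite ltr_pdivlMr// => h.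
  apply: le_lt_trans h.
  have -> : `|s - t| * (K1 + K2) = `|s * (K1 + K2) - t * (K1 + K2)|.
    by rewrite -mulrBl normrM (ger0_norm (ltW K0)).
  have /andP[u0 u1] := inK s s01; have /andP[w0 w1] := inK t t01.
  have -> : s * (K1 + K2) - t * (K1 + K2) =
     (s * (K1 + K2) - K1) - (t * (K1 + K2) - K1) by lra.
  move: (s * _ - _) (t * _ - _) u0 u1 w0 w1 => u w u0 u1 w0 w1.
  have [uw|wu] := leP u w.
    by rewrite distrC; apply: le_trans (ler_norm _); exact: gl.
  by rewrite metric_sym; apply: le_trans (ler_norm _); apply: gl => //; lra.
- suff qc : {within A1 `|` A2, continuous q}.
    move=> x; apply: cvgMl; apply: cvgD; first exact: qc.
    exact: cvg_cst.
  apply: withinU_continuous.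
  + exact: isometric_image_closed.
  + exact: isometric_image_closed.
  + apply: within_continuous_fun => z [s /=]; rewrite in_itv /= => s01 <- e e0.
    exists e => // y [t /=]; rewrite in_itv /= => t01 <- h; apply: le_lt_trans h.
    by rewrite !q1// i1// opprK addrC distrC.
  + apply: within_continuous_fun => z [s /=]; rewrite in_itv /= => s01 <- e e0.
    exists e => // y [t /=]; rewrite in_itv /= => t01 <- h; apply: le_lt_trans h.
    by rewrite !q2// i2.
- move=> u; rewrite in_itv /= => /inK uK.
  by rewrite qg// subrK mulfK.
Qed.

End Arcs.

(** * From unique arcs to the four-point condition *)

Section RtreeFourPoint.
Context {R : realType} {T : metricType R}.
Implicit Types a b x y z w m : T.
Hypothesis TR : is_Rtree T.

Lemma Rtree_btw_uniq a b m n : btw a m b -> btw a n b -> mdist a m = mdist a n ->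
  m = n.
Proof.
case: TR => _ Tg Ta h1 h2 e.
have [ab|/eqP ab] := eqVneq a b.
  have d0 k : btw a k b -> a = k.
    move=> h; apply: mdist_positivity; move: h; rewrite /btw -ab mdistxx.
    have := mdist_ge0 a k; have := mdist_ge0 k a; lra.
  by rewrite -(d0 m)// -(d0 n).
have [c gc cm] := geodesic_concat h1 Tg; have [c' gc' cn] := geodesic_concat h2 Tg.
have [A [_ uA]] := Ta a b ab.
have : (c' @` `[0, mdist a b]) n.
  exists (mdist a n) => //=; rewrite in_itv /= mdist_ge0 /=.
  by rewrite -h2 lerDl mdist_ge0.
rewrite -(uA _ (geodesic_arc ab gc')) (uA _ (geodesic_arc ab gc)).
move=> [s /=]; rewrite in_itv /= => sl cs.
by have [ds _] := geodesic_pathE gc sl; rewrite -cs -ds cs -e cm.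
Qed.

(** Let [s] be the last time at which the geodesics from [x] to [y] and to [z] agree. What remains
    of them meets only at [c1 s], so it forms an arc from [y] to [z]. By uniqueness this arc is the
    geodesic [[y, z]], which therefore contains [c1 s]. *)
Lemma Rtree_median x y z : exists m, [/\ btw x m y, btw x m z & btw y m z].
Proof.
have [<-|/eqP yz] := eqVneq y z.
  by exists y; split; [exact: btwyy|exact: btwyy|exact: btwxx].
case: TR => _ Tg Ta.
have [c1 g1] := Tg x y; have [c2 g2] := Tg x z.
have [c10 c1y c1i] := g1; have [c20 c2z c2i] := g2.
pose L1 := mdist x y; pose L2 := mdist x z.
pose E := [set t | [/\ 0 <= t, t <= L1, t <= L2 & c1 t = c2 t]].
have E0 : E 0 by split; rewrite ?mdist_ge0// c10 c20.
have EB : has_sup E by split; [exists 0|exists L1 => t []].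
pose s := sup E.
have s0 : 0 <= s by apply: ub_le_sup => //; case: EB.
have sL1 : s <= L1 by apply: ge_sup; [exists 0|move=> t []].
have sL2 : s <= L2 by apply: ge_sup; [exists 0|move=> t []].
have ms : c1 s = c2 s.
  apply: mdist_positivity; apply/eqP; rewrite eq_le mdist_ge0 andbT leNgt.
  apply/negP => d0.
  (* A time of agreement within a quarter of the gap from [s] would bound the gap by half of
     itself. *)
  have [t [t0 t1 t2 ct] ts] := sup_adherent (divr_gt0 d0 (ltr0n _ 4)) EB.
  have ts' : t <= s by apply: ub_le_sup; [case: EB|split].
  have := metric_triangle (c1 s) (c1 t) (c2 s).
  rewrite c1i ?in_itv /= ?s0 ?sL1 ?t0 ?t1// ct.
  rewrite c2i ?in_itv /= ?s0 ?sL2 ?t0 ?t2//.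
  rewrite -/s in ts; move: (mdist _ _) d0 ts => d d0 ts.
  rewrite ger0_norm ?ler0_norm; lra.
have same t t' : s <= t <= L1 -> s <= t' <= L2 -> c1 t = c2 t' -> t = s.
  move=> /andP[h1 h2] /andP[h3 h4] e.
  have [|e1 _] := @geodesic_pathE _ _ _ _ _ t g1; first by rewrite h2 andbT; lra.
  have [|e2 _] := @geodesic_pathE _ _ _ _ _ t' g2; first by rewrite h4 andbT; lra.
  have tt : t = t' by rewrite -e1 -e2 e.
  apply/eqP; rewrite eq_le h1 andbT; apply: ub_le_sup; first by case: EB.
  by split=> //; [lra|rewrite tt|rewrite e tt].
have b1 : btw x (c1 s) y by apply: geodesic_path_btw g1 _; rewrite s0.
have b2 : btw x (c1 s) z by rewrite ms; apply: geodesic_path_btw g2 _; rewrite s0.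
exists (c1 s); split=> //.
have K0 : 0 < (L1 - s) + (L2 - s).
  rewrite lt_neqAle addr_ge0 ?subr_ge0// andbT eq_sym paddr_eq0 ?subr_ge0//.
  apply/negP => /andP[/eqP h1 /eqP h2]; apply: yz.
  have e1 : L1 = s by lra.
  have e2 : L2 = s by lra.
  by rewrite -c1y -c2z -/L1 -/L2 e1 e2.
have i1 (v w : R) : 0 <= v <= L1 - s -> 0 <= w <= L1 - s ->
    mdist (c1 (v + s)) (c1 (w + s)) = `|v - w|.
  move=> /andP[v0 v1] /andP[w0 w1]; rewrite c1i ?in_itv /= -/L1.
  - by rewrite opprD addrACA subrr addr0.
  - by apply/andP; split; lra.
  - by apply/andP; split; lra.
have i2 (v w : R) : 0 <= v <= L2 - s -> 0 <= w <= L2 - s ->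
    mdist (c2 (v + s)) (c2 (w + s)) = `|v - w|.
  move=> /andP[v0 v1] /andP[w0 w1]; rewrite c2i ?in_itv /= -/L2.
  - by rewrite opprD addrACA subrr addr0.
  - by apply/andP; split; lra.
  - by apply/andP; split; lra.
have i3 (v w : R) : 0 <= v <= L1 - s -> 0 <= w <= L2 - s ->
    c1 (v + s) = c2 (w + s) -> c1 (v + s) = c1 s.
  move=> /andP[v0 v1] /andP[w0 w1] e; rewrite (same (v + s) (w + s))//.
  - by apply/andP; split; lra.
  - by apply/andP; split; lra.
have := @join_arc _ _ (c1 s) (L1 - s) (L2 - s) (fun v => c1 (v + s))
  (fun v => c2 (v + s)).
rewrite !subr_ge0 !add0r !subrK c1y c2z.
move=> /(_ sL1 sL2 K0 erefl (esym ms) i1 i2 i3).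
move=> arcm; have [c3 g3] := Tg y z; have [A [_ uA]] := Ta y z yz.
have h : (c3 @` `[0, mdist y z]) (c1 s).
  rewrite -(uA _ (geodesic_arc yz g3)) (uA _ arcm); left; exists 0 => /=.
    by rewrite in_itv /= lexx subr_ge0.
  by rewrite add0r.
by apply/segmentE => //; exists c3.
Qed.

(** With [n] the median of [a], [b], [w], the point [m] lies on [[a, n]] or on [[b, n]], and these
    are parts of [[a, w]] and [[b, w]]. *)
Lemma Rtree_btw_or a m b w : btw a m b -> btw a m w \/ btw b m w.
Proof.
have Tg : geodesic_space T by case: TR.
have key a' b' n : btw a' m b' -> btw a' n b' -> btw a' n w -> 
    mdist a' m <= mdist a' n -> btw a' m w.
  move=> h1 h2 h3 le; have [c gc] := Tg a' n.
  have dm : 0 <= mdist a' m <= mdist a' n by rewrite mdist_ge0.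
  have h4 := geodesic_path_btw gc dm; have [h5 _] := geodesic_pathE gc dm.
  have e : m = c (mdist a' m).
    exact: Rtree_btw_uniq h1 (btw_trans h2 h4) (esym h5).
  by rewrite -e in h4; exact: btw_trans h3 h4.
move=> h; have [n [h1 h2 h3]] := Rtree_median a b w.
have [le|le] := leP (mdist a m) (mdist a n).
  by left; apply: key h1 h2 le.
right; apply: key (btw_sym h) (btw_sym h1) h3 _.
move: h h1; rewrite /btw (metric_sym b n) (metric_sym b m); lra.
Qed.

(** At least two of the geodesics from [w] to [x], [y], [z] pass through the median of these three
    points; the rest is linear. *)
Lemma Rtree_fourpt : fourpt T.
Proof.
move=> x y z w; have [m [h1 h2 h3]] := Rtree_median x y z.
have tw u := metric_triangle w m u; have tu u := metric_triangle u m w.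
have := Rtree_btw_or w h1; have := Rtree_btw_or w h2; have := Rtree_btw_or w h3.
have := tw x; have := tw y; have := tw z; rewrite (metric_sym y w) (metric_sym x w).
rewrite (metric_sym z w); move: h1 h2 h3; rewrite /btw !(metric_sym _ w).
rewrite !(metric_sym _ m) => e1 e2 e3 t1 t2 t3.
case=> h1; case=> h2; case=> h3; lra.
Qed.

End RtreeFourPoint.

(** Points of [[a, b]] at prescribed distances from [a] may be chosen independently: the four-point
    condition makes the choice isometric. *)
Lemma fourpt_geodesic {R : realType} (T : metricType R) : fourpt T ->
  (forall (a b : T) s, 0 <= s <= mdist a b ->
     exists2 m, btw a m b & mdist a m = s) ->
  geodesic_space T.
Proof.
move=> T4 Tp a b.
have H s : exists m, 0 <= s <= mdist a b -> btw a m b /\ mdist a m = s.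
  have [h|h] := pselect (0 <= s <= mdist a b); last by exists a.
  by have [m h1 h2] := Tp a b s h; exists m.
have {H} [c cP] := choice H; exists c.
have D0 := mdist_ge0 a b.
split.
- have [|_ h] := cP 0; first by rewrite lexx.
  exact/esym/mdist_positivity.
- have [|h e] := cP (mdist a b); first by rewrite lexx andbT.
  apply/mdist_positivity/(addrI (mdist a b)); by rewrite addr0 -[RHS]h e.
move=> s t; rewrite !in_itv /= => hs ht.
have [h1 e1] := cP _ hs; have [h2 e2] := cP _ ht.
have := T4 a b (c s) (c t).
have := metric_triangle a (c s) (c t); have := metric_triangle a (c t) (c s).
move: h1 h2; rewrite /btw e1 e2 (metric_sym b (c t)) (metric_sym b (c s)).
rewrite (metric_sym (c t) (c s)).
move=> h1 h2 t1 t2 h; apply/eqP.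
have [st|st] := leP s t.
  by rewrite ler0_norm ?subr_le0// eq_le; apply/andP; split; lra.
by rewrite ger0_norm ?subr_ge0 1?ltW// eq_le; apply/andP; split; lra.
Qed.

(** * Invariant subsets of a product of two trees *)

Section L1Subspace.
Context {R : realType} {T1 T2 : metricType R}.

Definition l1sub (S : set (T1 * T2)) : Type := {z | S z}.

Definition l1dist (z w : T1 * T2) : R := mdist z.1 w.1 + mdist z.2 w.2.

Variable S : set (T1 * T2).

HB.instance Definition _ := gen_eqMixin (l1sub S).
HB.instance Definition _ := gen_choiceMixin (l1sub S).

Let d (z w : l1sub S) := l1dist (sval z) (sval w).

Let dxx z : d z z = 0.
Proof. by rewrite /d /l1dist !mdistxx addr0. Qed.

Let dpos z w : d z w = 0 -> z = w.
Proof.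
case: z w => -[z1 z2] Sz [[w1 w2] Sw].
move=> /eqP; rewrite /d /l1dist /= paddr_eq0 ?mdist_ge0// => /andP[/eqP h1 /eqP h2].
apply: eq_exist.
by rewrite (mdist_positivity _ _ h1) (mdist_positivity _ _ h2).
Qed.

Let dsym z w : d z w = d w z.
Proof. by rewrite /d /l1dist !(metric_sym (sval z).1, metric_sym (sval z).2). Qed.

Let dtri y x z : d x z <= d x y + d y z.
Proof.
rewrite /d /l1dist.
have := metric_triangle (sval x).1 (sval y).1 (sval z).1.
have := metric_triangle (sval x).2 (sval y).2 (sval z).2; lra.
Qed.

HB.instance Definition _ := @isMetric.Build R (l1sub S) d dxx dpos dsym dtri.

Lemma l1subE (z w : l1sub S) : mdist z w = l1dist (sval z) (sval w).
Proof. by []. Qed.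

End L1Subspace.

Section L1Tree.
Context {R : realType} {G : groupType}.
Implicit Types T : Gtree R G.

Lemma gtree_fourpt T : fourpt T.
Proof. exact: Rtree_fourpt (gtree_Rtree T). Qed.

Lemma gtree_geodesic T : geodesic_space T.
Proof. by case: (gtree_Rtree T). Qed.

Definition l1_fourpt T1 T2 (S : set (T1 * T2)) := forall x y z w,
  S x -> S y -> S z -> S w ->
  l1dist x y + l1dist z w <= l1dist x z + l1dist y w \/
  l1dist x y + l1dist z w <= l1dist x w + l1dist y z.

Definition l1_geodesic T1 T2 (S : set (T1 * T2)) := forall x y s,
  S x -> S y -> 0 <= s <= l1dist x y ->
  exists m, [/\ S m, l1dist x m = s & l1dist m y = l1dist x y - s].

(** [d2] stands for the distance in the other factor. An equality in the triangle inequality of the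
    sum forces equality in both summands; conversely the image of a geodesic is a path and covers
    the segment between its ends. *)
Lemma preserves_alignment_l1 (T T1 : metricType R) (f : T -> T1) (d2 : T -> T -> R) :
  geodesic_space T -> geodesic_space T1 -> fourpt T1 ->
  (forall x y, 0 <= d2 x y) -> (forall x y z, d2 x z <= d2 x y + d2 y z) ->
  (forall x y, mdist x y = mdist (f x) (f y) + d2 x y) ->
  preserves_alignment f.
Proof.
move=> Tg T1g T14 d20 d2t fd a b; apply/seteqP; split=> w.
  move=> [z /(segmentE Tg) azb <-]; apply/(segmentE T1g).
  move: azb; rewrite /btw !fd => e; apply: btw_le.
  have := d2t a z b; lra.
move=> /(segmentE T1g) awb.
have [c gc] := Tg a b; have [c0 c1 ci] := gc.
have cc : {within `[0, mdist a b], continuous (f \o c)}.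
  apply/within_continuous_path => s ss e e0; exists e => // t tt st.
  rewrite (le_lt_trans _ st)// -ci//.
  by rewrite fd lerDl.
have := path_through T14 (mdist_ge0 a b) cc.
rewrite /= c0 c1 => /(_ _ awb)[u uab <-]; exists (c u) => //.
by exists c => //; exists u => //=; rewrite in_itv.
Qed.

(** Both directions build their tree here: one takes for [S] the image of a common refinement, the
    other the interpolated hull of an orbit. *)
Lemma l1_tree T1 T2 (S : set (T1 * T2)) :
  S !=set0 -> (forall g z, S z -> S (gact g z.1, gact g z.2)) ->
  l1_fourpt S -> l1_geodesic S ->
  exists (T : Gtree R G) (f1 : T -> T1) (f2 : T -> T2),
    [/\ [/\ equivariant f1, preserves_alignment f1,
            equivariant f2 & preserves_alignment f2],
        (forall x y, mdist x y = mdist (f1 x) (f1 y) + mdist (f2 x) (f2 y)) &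
        forall z, S z -> exists x, (f1 x, f2 x) = z].
Proof.
move=> [z0 Sz0] SG S4 Sg.
have T4 : fourpt (l1sub S).
  by move=> [x Sx] [y Sy] [z Sz] [w Sw]; rewrite !l1subE; exact: S4.
have Tg : geodesic_space (l1sub S).
  apply: (fourpt_geodesic T4) => -[a Sa] [b Sb] s; rewrite l1subE /= => h.
  have [m [Sm h1 h2]] := Sg a b s Sa Sb h.
  by exists (exist _ m Sm) => //; rewrite /btw !l1subE /= h1 h2 addrC subrK.
have TR : is_Rtree (l1sub S).
  by apply: fourpt_Rtree => //; exists (exist _ z0 Sz0).
pose act g (z : l1sub S) : l1sub S := exist _ _ (SG g _ (svalP z)).
have act1 z : act 1%g z = z.
  by case: z => -[z1 z2] Sz; apply: eq_exist => /=; rewrite !gact1.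
have actM g h z : act (g * h)%g z = act g (act h z).
  by case: z => -[z1 z2] Sz; apply: eq_exist => /=; rewrite !gactM.
have actI g x y : mdist (act g x) (act g y) = mdist x y.
  by rewrite !l1subE /l1dist /= !gact_isometry.
pose T := Build_Gtree TR act1 actM actI.
exists T, (fun z => (sval z).1), (fun z => (sval z).2); split=> //.
  split=> //.
  - apply: (@preserves_alignment_l1 (l1sub S) T1 (fun z => (sval z).1)
      (fun x y => mdist (sval x).2 (sval y).2)) => //.
    + exact: gtree_geodesic.
    + exact: gtree_fourpt.
    + by move=> x y; exact: mdist_ge0.
    + by move=> x y z; exact: metric_triangle.
  - apply: (@preserves_alignment_l1 (l1sub S) T2 (fun z => (sval z).2)
      (fun x y => mdist (sval x).1 (sval y).1)) => //.
    + exact: gtree_geodesic.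
    + exact: gtree_fourpt.
    + by move=> x y; exact: mdist_ge0.
    + by move=> x y z; exact: metric_triangle.
    + by move=> x y; rewrite addrC.
by move=> z Sz; exists (exist _ z Sz) => /=; case: z Sz.
Qed.

End L1Tree.

(** * Translation lengths and axes *)

Section Isometries.
Context {R : realType} {G : groupType}.
Variable T : Gtree R G.
Implicit Types (g h u v : G) (x y z m p : T).

Let T4 : fourpt T := @gtree_fourpt _ _ T.
Let Tg : geodesic_space T := @gtree_geodesic _ _ T.

Notation tl := (translation_length T).
Notation d := mdist.

Lemma gactK g x : gact g^-1%g (gact g x) = x.
Proof. by rewrite -gactM mulVg gact1. Qed.

Lemma gactKV g x : gact g (gact g^-1%g x) = x.
Proof. by rewrite -gactM mulgV gact1. Qed.

Lemma gact_mdistl g x y : d (gact g x) y = d x (gact g^-1%g y).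
Proof. by rewrite -{1}(gactKV g y) gact_isometry. Qed.

Lemma gact_btw g x m y : btw x m y <-> btw (gact g x) (gact g m) (gact g y).
Proof. by rewrite /btw !gact_isometry. Qed.

Lemma gact_expS g n x : gact (g ^+ n.+1)%g x = gact g (gact (g ^+ n)%g x).
Proof. by rewrite expgS gactM. Qed.

Lemma mdist_exp_le g n x : d x (gact (g ^+ n)%g x) <= n%:R * d x (gact g x).
Proof.
elim: n => [|n IH]; first by rewrite expg0 gact1 mdistxx mul0r.
rewrite gact_expS; have := metric_triangle x (gact g x) (gact g (gact (g ^+ n)%g x)).
by rewrite gact_isometry -natr1 mulrDl mul1r; lra.
Qed.

Lemma mulrn_bounded_le0 (e C : R) : (forall n : nat, n%:R * e <= C) -> e <= 0.
Proof.
move=> h; rewrite leNgt; apply/negP => e0.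
have := h (Num.truncn (C / e)).+1; rewrite leNgt => /negP; apply.
by rewrite -ltr_pdivrMr// truncnS_gt.
Qed.

Lemma has_inf_displacement g : has_inf [set d x (gact g x) | x in [set: T]].
Proof.
have [[x _] _ _] := gtree_Rtree T.
split; first by exists (d x (gact g x)), x.
by exists 0 => _ [y _ <-]; exact: mdist_ge0.
Qed.

Lemma tl_le g x : tl g <= d x (gact g x).
Proof. by apply: ge_inf; [case: (has_inf_displacement g)|exists x]. Qed.

Lemma tl_ge g (t : R) : (forall x, t <= d x (gact g x)) -> t <= tl g.
Proof.
move=> h; apply: lb_le_inf; first by case: (has_inf_displacement g).
by move=> _ [y _ <-].
Qed.

Lemma tl_ge0 g : 0 <= tl g.
Proof. by apply: tl_ge => x; exact: mdist_ge0. Qed.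

(* By the four-point condition the increments of [d x (g^n x)] do not decrease
   once [d x (g^n x)] exceeds [d x (g x)]. *)
Lemma orbit_growth g x (L := d x (gact g (gact g x)) - d x (gact g x)) n :
  0 < L -> d x (gact g x) + n%:R * L <= d x (gact (g ^+ n.+1)%g x).
Proof.
move=> L0; have [a aE] : exists a : nat -> R,
    forall k, a k = d x (gact (g ^+ k)%g x) by eexists.
have a1 : a 1%N = d x (gact g x) by rewrite aE expg1.
have a2 : a 2%N = a 1%N + L.
  by rewrite /L -a1 aE expgS expg1 gactM addrCA subrr addr0.
have step k : a 1%N < a k.+1 -> a k.+1 + a k.+1 <= a k.+2 + a k.
  move=> h; have := T4 x (gact (g ^+ k.+1)%g x) (gact g x) (gact (g ^+ k.+2)%g x).
  have e k' : d (gact g x) (gact (g ^+ k'.+1)%g x) = a k'.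
    by rewrite gact_expS aE; exact: gact_isometry.
  have -> : d (gact (g ^+ k.+1)%g x) (gact (g ^+ k.+2)%g x) = a 1%N.
    by rewrite a1 [(g ^+ k.+2)%g]expgSr gactM gact_isometry.
  rewrite e -!aE -a1 (metric_sym _ (gact g x)) e.
  by case; lra.
suff [h1 _] : a 1%N + n%:R * L <= a n.+1 /\ L <= a n.+2 - a n.+1.
  by rewrite -a1 -aE.
elim: n => [|n [IH1 IH2]]; first by rewrite mul0r addr0 a2; split; lra.
have h1 : a 1%N + n.+1%:R * L <= a n.+2 by rewrite -natr1 mulrDl mul1r; lra.
split=> //.
have h2 : a 1%N < a n.+2.
  have : 0 < n.+1%:R * L by rewrite mulr_gt0.
  by lra.
have := step n.+1 h2; lra.
Qed.

Lemma mdist_exp_shift g x y n :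
  d x (gact (g ^+ n)%g x) <= 2 * d x y + n%:R * d y (gact g y).
Proof.
have := mdist_exp_le g n y.
have := metric_triangle x y (gact (g ^+ n)%g x).
have := metric_triangle y (gact (g ^+ n)%g y) (gact (g ^+ n)%g x).
rewrite gact_isometry (metric_sym y x); lra.
Qed.

(** The orbit of [x] moves away by at least [L] per step, while replacing [x] by any [y] changes
    distances by a bounded amount; so [y] is moved by at least [L]. *)
Lemma tl_ge_orbit g x : d x (gact g (gact g x)) - d x (gact g x) <= tl g.
Proof.
set L := _ - _; have [L0|L0] := leP L 0; first exact: le_trans L0 (tl_ge0 g).
apply: tl_ge => y; rewrite -subr_le0.
apply: (@mulrn_bounded_le0 _ (2 * d x y + d y (gact g y))) => n.
rewrite mulrBr; have := orbit_growth n L0; have := mdist_exp_shift g x y n.+1.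
rewrite -[n.+1%:R]natr1 [(n%:R + 1) * _]mulrDl mul1r -/L.
have := mdist_ge0 x (gact g x); lra.
Qed.

(** The midpoint of [[x, gx]] has minimal displacement: [btw_dist], applied to this segment and to
    its translate, bounds its displacement by the value that [tl_ge_orbit] gives as a lower
    bound. *)
Lemma tl_attained g x : exists m, d m (gact g m) = tl g /\
  tl g = Num.max 0 (d x (gact g (gact g x)) - d x (gact g x)).
Proof.
pose D := d x (gact g x).
have D0 : 0 <= D := mdist_ge0 x (gact g x).
have [|m xm dm] := @btw_point _ _ Tg x (gact g x) (D / 2).
  by rewrite -/D; apply/andP; split; lra.
exists m.
have h0 : d m (gact g m) <= Num.max 0 (d x (gact g (gact g x)) - D).
  have := btw_dist T4 (gact g m) xm; rewrite gact_isometry.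
  have := btw_dist T4 x ((gact_btw g _ _ _).1 xm).
  rewrite !(metric_sym _ x) gact_isometry dm (metric_sym (gact g (gact g x))).
  rewrite gact_isometry -/D.
  have e : d m (gact g x) = D / 2 by move: xm; rewrite /btw dm -/D; lra.
  rewrite e (metric_sym _ m) e.
  rewrite !le_max => /orP h1 /orP h2; apply/orP.
  case: h2 => h2; last by left; lra.
  by case: h1 => h1; [left|right]; lra.
have h1 := tl_le g m; have h2 := tl_ge_orbit g x; have h3 := tl_ge0 g.
have h4 : Num.max 0 (d x (gact g (gact g x)) - D) <= tl g by rewrite ge_max h3.
by split; apply/eqP; rewrite eq_le; apply/andP; split; lra.
Qed.

Lemma tl_formula g x :
  tl g = Num.max 0 (d x (gact g (gact g x)) - d x (gact g x)).
Proof. by case: (tl_attained g x) => m []. Qed.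

(** The characteristic set: the axis of a hyperbolic element, the fixed points of an elliptic one.
    No parametrization of a line is needed. *)
Definition Ax g : set T := [set x | d x (gact g x) = tl g].

Lemma Ax_nonempty g : Ax g !=set0.
Proof.
have [[x _] _ _] := gtree_Rtree T.
by have [m [h _]] := tl_attained g x; exists m.
Qed.

Lemma Ax_btw g x : Ax g x -> btw x (gact g x) (gact g (gact g x)).
Proof.
move=> Axx; have [e|/eqP h] := eqVneq x (gact g x).
  by rewrite -!e; exact: btwxx.
have := tl_formula g x; rewrite -Axx => e; apply: btw_le; rewrite gact_isometry.
have : 0 < d x (gact g x) by rewrite mdist_gt0; apply/eqP.
by move: e; rewrite maxEle; case: ifP => _ e; lra.
Qed.

Lemma tl_btw g x : btw x (gact g x) (gact g (gact g x)) -> tl g = d x (gact g x).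
Proof.
move=> h; rewrite (tl_formula g x) -h gact_isometry addrK max_r//.
exact: mdist_ge0.
Qed.

Lemma Ax_exp g x n : Ax g x -> d x (gact (g ^+ n)%g x) = n%:R * tl g.
Proof.
move=> Axx; apply/eqP; rewrite eq_le -Axx mdist_exp_le /=.
case: n => [|n]; first by rewrite mul0r mdist_ge0.
have [e|/eqP h] := eqVneq (d x (gact g x)) 0; first by rewrite e mulr0 mdist_ge0.
have L : d x (gact g (gact g x)) - d x (gact g x) = d x (gact g x).
  by rewrite -(Ax_btw Axx) gact_isometry addrK.
have := @orbit_growth g x n; rewrite L => /(_ _) h0.
rewrite -natr1 mulrDl mul1r addrC h0// lt_neqAle mdist_ge0 andbT eq_sym.
exact/eqP.
Qed.

Lemma tl_asymptotic g x : exists C, forall n,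
  `|d x (gact (g ^+ n)%g x) - n%:R * tl g| <= C.
Proof.
have [m Am] := Ax_nonempty g; exists (2 * d x m) => n.
rewrite ler_norml; have := mdist_exp_shift g x m n.
have := metric_triangle m x (gact (g ^+ n)%g m).
have := metric_triangle x (gact (g ^+ n)%g x) (gact (g ^+ n)%g m).
rewrite gact_isometry (Ax_exp _ Am) (metric_sym m x) Am => h1 h2 h3.
by apply/andP; split; lra.
Qed.

Lemma Ax_conj g h x : Ax (h * g * h^-1)%g (gact h x) <-> 
  d x (gact g x) = tl (h * g * h^-1)%g.
Proof. by rewrite /Ax /= -gactM mulgVK gactM gact_isometry. Qed.

Lemma tl_conj g h : tl (h * g * h^-1)%g = tl g.
Proof.
apply/eqP; rewrite eq_le; apply/andP; split.
  apply: tl_ge => x; apply: le_trans (tl_le _ (gact h x)) _.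
  by rewrite -gactM mulgVK gactM gact_isometry.
apply: tl_ge => x; apply: le_trans (tl_le _ (gact h^-1%g x)) _.
by rewrite -(gact_isometry h) !gactM gactKV.
Qed.

Lemma AxJ g h x : Ax (h * g * h^-1)%g (gact h x) <-> Ax g x.
Proof. by rewrite Ax_conj tl_conj. Qed.

Lemma tlC g h : tl (g * h)%g = tl (h * g)%g.
Proof. by rewrite -[RHS](tl_conj _ g) !mulgA mulgK. Qed.

Lemma tlV g : tl g^-1%g = tl g.
Proof.
apply/eqP; rewrite eq_le; apply/andP; split; apply: tl_ge => x.
  by rewrite metric_sym gact_mdistl tl_le.
by rewrite -{1}(invgK g) metric_sym gact_mdistl invgK tl_le.
Qed.

Lemma AxV g : Ax g^-1%g = Ax g.
Proof.
have e x : d x (gact g^-1%g x) = d x (gact g x).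
  by rewrite metric_sym gact_mdistl invgK.
by apply/seteqP; split=> x; rewrite /Ax /= tlV e.
Qed.

Lemma Ax_gact g h x : (g * h = h * g)%g -> Ax g x -> Ax g (gact h x).
Proof. by move=> gh; rewrite /Ax /= -gactM gh gactM gact_isometry. Qed.

(** Displacement is convex along segments; [btw_dist] is used for [[x, y]] and for its translate. *)
Lemma Ax_convex g x m y : Ax g x -> Ax g y -> btw x m y -> Ax g m.
Proof.
move=> Axx Axy xmy; apply/eqP; rewrite eq_le tl_le andbT.
have h1 := btw_dist T4 (gact g m) xmy.
have xmy' := (gact_btw g _ _ _).1 xmy.
have h2 := btw_dist T4 x xmy'; have h3 := btw_dist T4 y xmy'.
have p1 := mdist_ge0 x m; have p2 := mdist_ge0 m y.
have := metric_triangle x y (gact g y); have := metric_triangle y x (gact g x).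
rewrite /Ax /= in Axx Axy; move: h1 h2 h3; rewrite !gact_isometry.
rewrite (metric_sym (gact g m) x) (metric_sym (gact g m) y).
rewrite (metric_sym (gact g x) x) (metric_sym (gact g y) y).
rewrite (metric_sym (gact g x) y) (metric_sym (gact g y) x) Axx Axy.
rewrite (metric_sym y x) (metric_sym y m); rewrite /btw in xmy.
rewrite !le_max => /orP h1 /orP h2 /orP h3 t1 t2.
by case: h1 => h1; [case: h2 => h2|case: h3 => h3]; lra.
Qed.

End Isometries.

(** * Axes as lines, projection to an axis, products of hyperbolic elements *)

Section Axes.
Context {R : realType} {G : groupType}.
Variable T : Gtree R G.
Implicit Types (g h u v : G) (x y z m p : T).

Let T4 : fourpt T := @gtree_fourpt _ _ T.
Let Tg : geodesic_space T := @gtree_geodesic _ _ T.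

Notation tl := (translation_length T).
Notation d := mdist.

Lemma Ax_expg g n x : Ax g x -> Ax g (gact (g ^+ n)%g x).
Proof.
move=> Axx; elim: n => [|n IH]; first by rewrite expg0 gact1.
by rewrite gact_expS; exact: Ax_gact.
Qed.

Lemma mdist_invexpl g n x y :
  d (gact (g ^+ n)^-1%g x) y = d x (gact (g ^+ n)%g y).
Proof. by rewrite gact_mdistl invgK. Qed.

Lemma Ax_btw_exp g n x : Ax g x ->
  btw (gact (g ^+ n)^-1%g x) x (gact (g ^+ n)%g x).
Proof.
move=> Axx; rewrite /btw !mdist_invexpl -gactM -expgnDr.
by rewrite !Ax_exp// natrD mulrDl.
Qed.

Lemma exists_nat_mul_gt (l C : R) : 0 < l -> exists n : nat, C < n%:R * l.
Proof.
move=> l0; exists (Num.truncn (C / l)).+1.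
by rewrite -ltr_pdivrMr// truncnS_gt.
Qed.

(** [z] lies between its own translates by [g^-n] and [g^n]. [btw_or] replaces these by the
    translates of [x], the bound on [d x z] excluding the wrong alternative each time. *)
Lemma Ax_on g x z n : Ax g x -> Ax g z -> d x z < n%:R * tl g ->
  btw (gact (g ^+ n)^-1%g x) z (gact (g ^+ n)%g x).
Proof.
move=> Axx Axz xz.
have h1 : btw (gact (g ^+ n)%g z) z (gact (g ^+ n)^-1%g x).
  case: (btw_or T4 (gact (g ^+ n)^-1%g x) (Ax_btw_exp n Axz)) => //.
  rewrite /btw gact_isometry mdist_invexpl (Ax_exp _ Axz).
  by rewrite (metric_sym z x); have := mdist_ge0 z (gact (g ^+ n)^-1%g x); lra.
case: (btw_or T4 (gact (g ^+ n)%g x) (btw_sym h1)) => //.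
rewrite /btw gact_isometry metric_sym (Ax_exp _ Axz).
by rewrite (metric_sym z x); have := mdist_ge0 z (gact (g ^+ n)%g x); lra.
Qed.

Lemma btw_sorted p q a b : btw p a q -> btw p b q -> d p a <= d p b -> btw p a b.
Proof.
move=> pa pb le; case: (btw_or T4 b pa) => //.
rewrite /btw in pa pb *; move: pa pb; rewrite (metric_sym q a) (metric_sym q b).
move=> pa pb e; have ab : d a b = 0.
  by apply/eqP; rewrite eq_le mdist_ge0 andbT; lra.
by move/mdist_positivity: ab => ->; rewrite mdistxx addr0.
Qed.

Definition aligned x y z := [\/ btw x y z, btw y x z | btw x z y].

Lemma btw_aligned p q x y z : btw p x q -> btw p y q -> btw p z q -> aligned x y z.
Proof.
move=> px py pz.
have H a b c : btw p a q -> btw p b q -> btw p c q ->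
    d p a <= d p b -> d p b <= d p c -> btw a b c.
  move=> pa pb pc ab bc.
  exact: btw_transr (btw_sorted pb pc bc) (btw_sorted pa pb ab).
have [xy|/ltW xy] := leP (d p x) (d p y).
  have [yz|/ltW yz] := leP (d p y) (d p z); first by apply: Or31; exact: H.
  have [xz|/ltW xz] := leP (d p x) (d p z); first by apply: Or33; exact: H.
  by apply: Or32; apply: btw_sym; exact: H.
have [xz|/ltW xz] := leP (d p x) (d p z); first by apply: Or32; exact: H.
have [yz|/ltW yz] := leP (d p y) (d p z).
  by apply: Or33; apply: btw_sym; exact: H.
by apply: Or31; apply: btw_sym; exact: H.
Qed.

Lemma Ax_aligned g x y z : 0 < tl g -> Ax g x -> Ax g y -> Ax g z -> aligned x y z.
Proof.
move=> g0 Axx Axy Axz.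
have [n nP] := exists_nat_mul_gt (d x y + d x z) g0.
have p1 := mdist_ge0 x y; have p2 := mdist_ge0 x z.
by apply: (btw_aligned (Ax_btw_exp n Axx) (Ax_on Axx Axy _) (Ax_on Axx Axz _)); lra.
Qed.

(** The projection of [y] to the axis is found on a finite piece of it as a median. If the piece is
    long enough, the projection is not an end of it, so longer pieces have the same projection. *)
Lemma Ax_gate g y : 0 < tl g -> exists2 c, Ax g c & forall z, Ax g z -> btw y c z.
Proof.
move=> g0; have [x Axx] := Ax_nonempty T g.
have [N NP] := exists_nat_mul_gt (d x y) g0.
pose P n := gact (g ^+ n)^-1%g x; pose Q n := gact (g ^+ n)%g x.
have [c [yP yQ PQ]] := median T4 Tg y (P N) (Q N).
have AP n : Ax g (P n) by rewrite /P -expVgn -AxV; apply: Ax_expg; rewrite AxV.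
have AQ n : Ax g (Q n) := Ax_expg n Axx.
have Axc : Ax g c by apply: Ax_convex PQ.
have dP n : d (P n) x = n%:R * tl g by rewrite /P mdist_invexpl Ax_exp.
have dQ n : d (Q n) x = n%:R * tl g by rewrite /Q metric_sym Ax_exp.
have dPQ n : d (P n) (Q n) = n%:R * tl g + n%:R * tl g.
  by rewrite -(Ax_btw_exp n Axx) -/(P n) -/(Q n) dP (metric_sym x) dQ.
have cPQ : c <> P N /\ c <> Q N.
  have := metric_triangle (P N) y x; have := metric_triangle (Q N) y x.
  have := metric_triangle (P N) x y; have := metric_triangle (Q N) x y.
  rewrite dP dQ => t1 t2 t3 t4.
  have := dPQ N; move: yP yQ PQ; rewrite /btw.
  rewrite (metric_sym (Q N) y) (metric_sym (P N) y) (metric_sym y x) in t1 t2 t3 t4.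
  rewrite (metric_sym (P N) c) => e1 e2 e3 e4.
  by split=> e; move: e1 e2 e3; rewrite e mdistxx => e1 e2 e3; lra.
exists c => // z Axz.
have [M' MP'] := exists_nat_mul_gt (d x z + d x c) g0.
(* [M'] makes the larger piece contain [z]; adding [N] makes it contain the first piece. *)
pose M := (M' + N)%N.
have MN : N%:R * tl g <= M%:R * tl g by rewrite ler_wpM2r ?(ltW g0)// ler_nat leq_addl.
have MP : d x z + d x c < M%:R * tl g.
  by apply: lt_le_trans MP' _; rewrite ler_wpM2r ?(ltW g0)// ler_nat leq_addr.
have p1 := mdist_ge0 x c; have p2 := mdist_ge0 x z.
have zM : btw (P M) z (Q M) by apply: Ax_on => //; lra.
have PN : btw (P M) (P N) (Q N) /\ btw (P N) (Q N) (Q M).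
  have e1 : d (P M) (Q N) = M%:R * tl g + N%:R * tl g.
    by rewrite /P /Q mdist_invexpl -gactM -expgnDr Ax_exp// natrD mulrDl.
  have e2 : d (P N) (Q M) = N%:R * tl g + M%:R * tl g.
    by rewrite /P /Q mdist_invexpl -gactM -expgnDr Ax_exp// natrD mulrDl.
  have eM : M = (M' + N)%N by [].
  have e3 : d (P M) (P N) = M%:R * tl g - N%:R * tl g.
    rewrite /P eM expgnDr invgM gactM gact_isometry.
    by rewrite mdist_invexpl Ax_exp// natrD mulrDl addrK.
  have e4 : d (Q N) (Q M) = M%:R * tl g - N%:R * tl g.
    by rewrite /Q eM addnC expgnDr gactM gact_isometry Ax_exp// natrD mulrDl addrC addKr.
  by rewrite /btw e1 e2 e3 e4 !dPQ; split; lra.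
have [PN1 PN2] := PN; have [cP cQ] := cPQ.
have yPM : btw y c (P M).
  by have [] := btw_chain T4 yP (btw_transr (btw_sym PN1) (btw_sym PQ)) cP.
have yQM : btw y c (Q M).
  by have [] := btw_chain T4 yQ (btw_transr PN2 PQ) cQ.
case: (btw_or T4 c zM) => h.
  exact: btw_sym (btw_transr (btw_sym yPM) h).
exact: btw_sym (btw_transr (btw_sym yQM) h).
Qed.

Lemma tl_mul_le u v p q : Ax u p -> Ax v q ->
  tl (u * v)%g <= tl u + tl v + 2 * d p q.
Proof.
move=> Ap Aq; apply: le_trans (tl_le _ q) _; rewrite gactM.
have := metric_triangle q p (gact u (gact v q)).
have := metric_triangle p (gact u p) (gact u (gact v q)).
have := metric_triangle (gact u p) (gact u q) (gact u (gact v q)).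
rewrite !gact_isometry Ap Aq (metric_sym q p); lra.
Qed.

(* The axes are joined by [p, q]; the orbit of [p] under [v * u] runs along
   [p, q], the axis of [v], the translate of [q, p] by [v], the axis of
   [v * u * v^-1], and so on, without backtracking. *)
Lemma tl_mul_bridge u v p q : Ax u p -> Ax v q -> p <> q ->
  btw (gact u^-1%g p) p q -> btw p q (gact v q) -> btw (gact v^-1%g q) q p ->
  btw q p (gact u p) -> 0 < tl u -> 0 < tl v ->
  tl (u * v)%g = tl u + tl v + 2 * d p q.
Proof.
move=> Ap Aq pq b1 b2 b3 b4 u0 v0.
have pq' : q <> p by move=> e; exact: pq.
have vq : q <> gact v q by apply/eqP; rewrite -mdist_gt0 Aq.
have up : p <> gact u p by apply/eqP; rewrite -mdist_gt0 Ap.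
have gne g x y : x <> y -> gact g x <> gact g y.
  by move=> xy e; apply: xy; rewrite -(gactK g x) e gactK.
rewrite tlC.
have c1 := b2.
have c2 : btw q (gact v q) (gact v p).
  by apply: (gact_btw v^-1%g _ _ _).2; rewrite !gactK.
have c3 : btw (gact v q) (gact v p) (gact v (gact u p)) := (gact_btw v _ _ _).1 b4.
have c4 : btw (gact v p) (gact (v * u)%g p) (gact (v * u)%g q).
  rewrite !gactM; apply: (gact_btw v _ _ _).1; apply: (gact_btw u^-1%g _ _ _).2.
  by rewrite !gactK.
have [_ d1] := btw_chain T4 c1 c2 vq.
have [_ d2] := btw_chain T4 d1 c3 (gne v _ _ pq').
rewrite -gactM in d2.
have e1 : d p (gact (v * u)%g p) = tl u + tl v + 2 * d p q.
  move: d2 d1 c1; rewrite /btw gactM !gact_isometry Aq Ap (metric_sym q p) => <- <- <-.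
  lra.
rewrite -e1; apply: tl_btw.
have vwp : gact v p <> gact (v * u)%g p by rewrite gactM; exact: gne.
have [_ d3] := btw_chain T4 d2 c4 vwp.
have d4 : btw p q (gact (v * u)%g p).
  exact: btw_trans d2 (btw_trans d1 c1).
have := (gact_btw (v * u)%g _ _ _).1 d4.
by move/(btw_chain T4 d3) => /(_ (gne _ _ _ pq))[].
Qed.

End Axes.

(** * Disjoint axes *)

Section DisjointAxes.
Context {R : realType} {G : groupType}.
Variable T : Gtree R G.
Implicit Types (g h u v a b : G) (x y z m p q : T).

Let T4 : fourpt T := @gtree_fourpt _ _ T.

Notation tl := (translation_length T).
Notation d := mdist.

Definition disjoint_axes u v := forall x, Ax u x -> ~ @Ax _ _ T v x.

Lemma disjoint_axesV u v : disjoint_axes u v -> disjoint_axes u v^-1%g.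
Proof. by move=> uv x; rewrite AxV; exact: uv. Qed.

(** The way back from lengths to geometry: it transfers disjointness to the tree of the sum, of
    which only the lengths are given. *)
Lemma disjoint_axes_tl u v : tl u + tl v < tl (u * v)%g -> disjoint_axes u v.
Proof.
move=> h x ux vx; have := tl_mul_le ux vx.
by rewrite mdistxx mulr0; lra.
Qed.

(** [p] is the gate of an arbitrary point of the axis of [v], and [q] the gate of [p]; since
    [p <> q], the pieces chain up. *)
Lemma bridge u v : 0 < tl u -> 0 < tl v -> disjoint_axes u v ->
  exists p q, [/\ Ax u p, Ax v q, p <> q &
    forall z y, Ax u z -> Ax v y -> d z y = d z p + d p q + d q y].
Proof.
move=> u0 v0 uv; have [y0 vy0] := Ax_nonempty T v.
have [p up pP] := Ax_gate y0 u0; have [q vq qP] := Ax_gate p v0.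
have pq : p <> q by move=> e; apply: (uv p up); rewrite e.
exists p, q; split=> // z y uz vy.
have h1 := pP z uz; have h2 := qP y0 vy0; have h3 := qP y vy.
have h4 : btw z p q by apply: btw_sym; apply: btw_transr h1 (btw_sym h2).
by have [h5 <-] := btw_chain T4 h4 h3 pq; rewrite h4.
Qed.

Lemma bridge_btw u v p q : Ax u p -> Ax v q ->
  (forall z y, Ax u z -> Ax v y -> d z y = d z p + d p q + d q y) ->
  (forall z, Ax u z -> btw z p q) /\ (forall y, Ax v y -> btw p q y).
Proof.
move=> up vq h; split=> [z uz|y vy]; rewrite /btw.
  by rewrite (h z q)// mdistxx addr0.
by rewrite (h p y)// mdistxx add0r.
Qed.

Lemma Ax_gactV g x : Ax g x -> Ax g (gact g^-1%g x).
Proof. by apply: Ax_gact; rewrite mulgV mulVg. Qed.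

Lemma Ax_gact1 g x : Ax g x -> Ax g (gact g x).
Proof. exact: Ax_gact. Qed.

Lemma bridge_tl u v p q : 0 < tl u -> 0 < tl v -> Ax u p -> Ax v q -> p <> q ->
  (forall z y, Ax u z -> Ax v y -> d z y = d z p + d p q + d q y) ->
  tl (u * v)%g = tl u + tl v + 2 * d p q.
Proof.
move=> u0 v0 up vq pq /(bridge_btw up vq)[h1 h2].
apply: tl_mul_bridge => //.
- exact/h1/Ax_gactV.
- exact/h2/Ax_gact1.
- exact/btw_sym/h2/Ax_gactV.
- exact/btw_sym/h1/Ax_gact1.
Qed.

(** The translate of the axis of [u] by [v] hangs from the axis of [v] at [v q], away from [q], so
    all of it projects to the foot [p] of the bridge. *)
Lemma moved_axis u v : 0 < tl u -> 0 < tl v -> disjoint_axes u v ->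
  exists2 p, Ax u p & forall y, Ax u y ->
    gact v y <> p /\ forall z, Ax u z -> btw (gact v y) p z.
Proof.
move=> u0 v0 uv; have [p [q [up vq pq h]]] := bridge u0 v0 uv.
have [h1 h2] := bridge_btw up vq h.
have nq : q <> gact v q by apply/eqP; rewrite -mdist_gt0 vq.
have b0 z y : Ax u z -> Ax v y -> btw z q y.
  by move=> uz vy; rewrite /btw (h z y)// (h z q)// mdistxx addr0.
exists p => // y uy.
have b1 z : Ax u z -> btw z q (gact v y).
  move=> uz; have b2 : btw q (gact v q) (gact v y).
    apply: (gact_btw v^-1%g _ _ _).2; rewrite !gactK.
    exact: btw_sym (b0 _ _ uy (Ax_gactV vq)).
  have b3 := b0 _ _ uz (Ax_gact1 vq).
  by have [] := btw_chain T4 b3 b2 nq.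
split=> [e|z uz].
  apply: pq; apply: mdist_positivity; have := b1 p up.
  rewrite e /btw mdistxx (metric_sym q p) => /eqP.
  by rewrite -mulr2n mulrn_eq0 /= => /eqP.
by apply/btw_sym; apply: btw_trans (b1 z uz) (h1 z uz).
Qed.

Lemma Ax_exp_neq a p n k : 0 < tl a -> Ax a p -> n != k ->
  gact (a ^+ n)%g p <> gact (a ^+ k)%g p.
Proof.
move=> a0 ap; wlog nk : n k / (n < k)%N => [H nk|_].
  by case: ltngtP (nk) => // h _; [exact: H|move/esym; apply: H; rewrite // eq_sym].
rewrite -(subnKC (ltnW nk)) expgnDr gactM => e.
have : d (gact (a ^+ n)%g p) (gact (a ^+ n)%g (gact (a ^+ (k - n))%g p)) = 0.
  by rewrite -e mdistxx.
rewrite gact_isometry Ax_exp// => /eqP; rewrite mulf_eq0 (gt_eqF a0) orbF.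
by rewrite pnatr_eq0 subn_eq0 leqNgt nk.
Qed.

(** [B] hangs from the axis at [p] and its translates hang from distinct points [a^n p]. Geodesics
    between different translates run along the axis, off which all three points lie, so none is
    between the others. Hence a line meets at most two translates. *)
Lemma hanging_not_aligned a p (B : set T) y0 y1 y2 n0 n1 n2 :
  0 < tl a -> Ax a p ->
  (forall y, B y -> y <> p /\ forall z, Ax a z -> btw y p z) ->
  B y0 -> B y1 -> B y2 -> n0 != n1 -> n0 != n2 -> n1 != n2 ->
  ~ aligned (gact (a ^+ n0)%g y0) (gact (a ^+ n1)%g y1) (gact (a ^+ n2)%g y2).
Proof.
move=> a0 ap BP B0 B1 B2 n01 n02 n12.
pose P n := gact (a ^+ n)%g p.
have AP n : Ax a (P n) by exact: Ax_expg.
have gate y n k : B y -> btw (gact (a ^+ n)%g y) (P n) (P k).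
  move=> By; apply: (gact_btw (a ^+ n)^-1%g _ _ _).2; rewrite !gactK.
  have [_] := BP y By; apply.
  by rewrite -expVgn -AxV; apply: Ax_expg; rewrite AxV.
have dist y y' n k : B y -> B y' -> n != k ->
    d (gact (a ^+ n)%g y) (gact (a ^+ k)%g y') = d y p + d (P n) (P k) + d y' p.
  move=> By By' nk; have h1 := gate y n k By; have h2 := gate y' k n By'.
  have [h3 h4] := btw_chain T4 h1 (btw_sym h2) (Ax_exp_neq a0 ap nk).
  by rewrite -h4 -h1 gact_isometry (metric_sym (P k)) gact_isometry.
have pos y : B y -> 0 < d y p.
  by move=> /BP[h _]; rewrite mdist_gt0; apply/eqP.
have := pos _ B0; have := pos _ B1; have := pos _ B2 => p2 p1 p0.
have n10 : n1 != n0 by rewrite eq_sym.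
have n21 : n2 != n1 by rewrite eq_sym.
case; rewrite /btw.
- rewrite (dist _ _ _ _ B0 B1 n01) (dist _ _ _ _ B1 B2 n12) (dist _ _ _ _ B0 B2 n02).
  have := metric_triangle (P n0) (P n1) (P n2); lra.
- rewrite (dist _ _ _ _ B1 B0 n10) (dist _ _ _ _ B0 B2 n02) (dist _ _ _ _ B1 B2 n12).
  have := metric_triangle (P n1) (P n0) (P n2); lra.
- rewrite (dist _ _ _ _ B0 B2 n02) (dist _ _ _ _ B2 B1 n21) (dist _ _ _ _ B0 B1 n01).
  have := metric_triangle (P n0) (P n2) (P n1); lra.
Qed.

(** The axis of [u] cannot meet the axes of all three conjugates of [b] by [1], [a] and [a^2]. *)
Lemma exists_disjoint_axis u a b : 0 < tl u -> 0 < tl a -> 0 < tl b ->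
  disjoint_axes a b -> exists2 v, 0 < tl v & disjoint_axes u v.
Proof.
move=> u0 a0 b0 ab; have [p [q [ap bq pq h]]] := bridge a0 b0 ab.
have [h1 h2] := bridge_btw ap bq h.
have BP y : Ax b y -> y <> p /\ forall z, Ax a z -> btw y p z.
  move=> By; split=> [e|z az]; first by apply: ab ap _; rewrite -e.
  by apply: btw_sym; rewrite /btw (h z y)// (h p y)// mdistxx add0r addrA.
apply: contrapT => H.
have F n : exists2 y : T, Ax b y & Ax u (gact (a ^+ n)%g y).
  apply: contrapT => nF; apply: H.
  exists (a ^+ n * b * (a ^+ n)^-1)%g; first by rewrite tl_conj.
  move=> x ux bx; apply: nF; exists (gact (a ^+ n)^-1%g x); last by rewrite gactKV.
  by apply: (AxJ b (a ^+ n)%g _).1; rewrite gactKV.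
have [y0 B0 U0] := F 0; have [y1 B1 U1] := F 1%N; have [y2 B2 U2] := F 2.
have := @hanging_not_aligned a p (Ax b) y0 y1 y2 0 1 2 a0 ap BP B0 B1 B2 isT isT isT.
by apply; exact: Ax_aligned U0 U1 U2.
Qed.

Lemma gact_aligned g x y z : aligned x y z -> aligned (gact g x) (gact g y) (gact g z).
Proof.
by case=> h; [apply: Or31|apply: Or32|apply: Or33]; exact: ((gact_btw _ _ _ _).1 h).
Qed.

Definition meets_axis u g := exists2 y, Ax u y & @Ax _ _ T u (gact g y).

(** The translate of the axis of [u] by [v^-1] hangs from that axis, and its translates by powers of
    [u^-1] would have to meet the line [w Ax u] three times. Nothing is asked of [w], which is thus
    free to serve the other tree. *)
Lemma meets_axis_left u v w n0 n1 n2 : 0 < tl u -> 0 < tl v -> disjoint_axes u v ->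
  n0 != n1 -> n0 != n2 -> n1 != n2 ->
  meets_axis u (v * u ^+ n0 * w)%g -> meets_axis u (v * u ^+ n1 * w)%g ->
  ~ meets_axis u (v * u ^+ n2 * w)%g.
Proof.
move=> u0 v0 uv n01 n02 n12 [y0 U0 V0] [y1 U1 V1] [y2 U2 V2].
have vV0 : 0 < tl v^-1%g by rewrite tlV.
have uV0 : 0 < tl u^-1%g by rewrite tlV.
have [p up pP] := moved_axis u0 vV0 (disjoint_axesV uv).
have eq n y : gact (u^-1 ^+ n)%g (gact v^-1%g (gact (v * u ^+ n * w)%g y)) = gact w y.
  by rewrite !gactM gactK expVgn gactK.
pose B : set T := [set gact v^-1%g z | z in @Ax _ _ T u].
have := @hanging_not_aligned u^-1%g p B _ _ _ n0 n1 n2 uV0 _ _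
  (ex_intro2 _ _ _ V0 erefl) (ex_intro2 _ _ _ V1 erefl)
  (ex_intro2 _ _ _ V2 erefl) n01 n02 n12.
rewrite !eq AxV; apply=> //.
- by move=> _ [z uz <-]; exact: pP.
- exact/gact_aligned/(Ax_aligned u0).
Qed.

(** The mirror image: [w Ax u] hangs from the axis, the line is [v^-1 Ax u], and [v] is
    arbitrary. *)
Lemma meets_axis_right u v w n0 n1 n2 : 0 < tl u -> 0 < tl w -> disjoint_axes u w ->
  n0 != n1 -> n0 != n2 -> n1 != n2 ->
  meets_axis u (v * u ^+ n0 * w)%g -> meets_axis u (v * u ^+ n1 * w)%g ->
  ~ meets_axis u (v * u ^+ n2 * w)%g.
Proof.
move=> u0 w0 uw n01 n02 n12 [y0 U0 V0] [y1 U1 V1] [y2 U2 V2].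
have [p up pP] := moved_axis u0 w0 uw.
have eq n y : gact (u ^+ n)%g (gact w y) = gact v^-1%g (gact (v * u ^+ n * w)%g y).
  by rewrite !gactM gactK.
pose B : set T := [set gact w z | z in @Ax _ _ T u].
have := @hanging_not_aligned u p B _ _ _ n0 n1 n2 u0 up _
  (ex_intro2 _ _ _ U0 erefl) (ex_intro2 _ _ _ U1 erefl)
  (ex_intro2 _ _ _ U2 erefl) n01 n02 n12.
rewrite !eq; apply=> //.
- by move=> _ [z uz <-]; exact: pP.
- exact/gact_aligned/(Ax_aligned u0).
Qed.

Lemma disjoint_axes_conj u g : ~ meets_axis u g -> disjoint_axes u (g * u * g^-1)%g.
Proof.
move=> h x ux gx; apply: h; exists (gact g^-1%g x); last by rewrite gactKV.
by apply: (AxJ u g _).1; rewrite gactKV.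
Qed.

End DisjointAxes.

(** * Consequences of irreducibility; hyperbolic products with an elliptic factor *)

Section Irreducible.
Context {R : realType} {G : groupType}.
Variable T : Gtree R G.
Implicit Types (g h u v a b : G) (x y z m p q : T).

Let T4 : fourpt T := @gtree_fourpt _ _ T.
Let Tg : geodesic_space T := @gtree_geodesic _ _ T.

Notation tl := (translation_length T).
Notation d := mdist.

Lemma gact_inj g x y : gact g x = gact g y -> x = y.
Proof. by move=> e; rewrite -(gactK g x) e gactK. Qed.

Lemma Ax_sub_axis g (A : set T) : 0 < tl g -> is_axis g A -> Ax g `<=` A.
Proof.
move=> g0 [c [ci -> cg]] z gz.
have cgn n t : gact (g ^+ n)%g (c t) = c (t + n%:R * tl g).
  elim: n => [|n IH]; first by rewrite expg0 gact1 mul0r addr0.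
  by rewrite gact_expS IH cg -natr1 mulrDl mul1r addrA.
have A0 : Ax g (c 0).
  by rewrite /Ax /= cg ci add0r sub0r normrN ger0_norm// ltW.
have [n nP] := exists_nat_mul_gt (d (c 0) z) g0.
have := Ax_on A0 gz nP.
have -> : gact (g ^+ n)^-1%g (c 0) = c (- (n%:R * tl g)).
  by rewrite -{1}(addNr (n%:R * tl g)) -cgn gactK.
rewrite cgn add0r; set l := n%:R * tl g => zb.
have l0 : 0 < l by apply: le_lt_trans nP; exact: mdist_ge0.
have s0 := mdist_ge0 (c (- l)) z.
have s1 : d (c (- l)) z <= l + l.
  have := mdist_ge0 z (c l); move: zb; rewrite /btw ci ler0_norm; lra.
exists (- l + d (c (- l)) z) => //.
apply: (btw_uniq T4 _ zb); rewrite /btw ?ci.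
  by rewrite !ler0_norm; lra.
by rewrite ler0_norm; lra.
Qed.

(** If the axes of [g] and [h] meet, conjugate [g] by a power of [h] that shifts by more than the
    overlap [M]. A common point [z] of the axis of [g] and its translate would have a projection [w]
    to the axis of [h] such that [w] and its shift back both lie in the overlap. *)
Lemma irreducible_disjoint_axes : irreducible_action T ->
  exists a b, [/\ 0 < tl a, 0 < tl b & disjoint_axes T a b].
Proof.
move=> [g [h [g0 h0 [A [B [gA hB [M MP]]]]]]]; rewrite /hyperbolic in g0 h0.
case: (pselect (disjoint_axes T g h)) => [gh|]; first by exists g, h.
move=> /existsNP[k /not_implyP[gk /contrapT hk]].
have [n nP] := exists_nat_mul_gt M h0.
exists g, (h ^+ n * g * (h ^+ n)^-1)%g; split=> //; first by rewrite tl_conj.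
move=> z gz bz; pose z' := gact (h ^+ n)^-1%g z.
have gz' : Ax g z' by apply: (AxJ g (h ^+ n)%g _).1; rewrite gactKV.
have [w hw wP] := Ax_gate z h0; have [w' hw' w'P] := Ax_gate z' h0.
have gw : Ax g w := Ax_convex gz gk (wP k hk).
have gw' : Ax g w' := Ax_convex gz' gk (w'P k hk).
have hV y : Ax h y -> Ax h (gact (h ^+ n)^-1%g y).
  by rewrite -expVgn -AxV => hy; exact: Ax_expg.
have e : gact (h ^+ n)%g w' = w.
  have h1 := wP _ (Ax_expg n hw').
  have h2 := (gact_btw (h ^+ n)%g _ _ _).1 (w'P _ (hV _ hw)).
  rewrite /z' !gactKV in h2; apply: mdist_positivity; apply/eqP.
  rewrite eq_le mdist_ge0 andbT; move: h1 h2; rewrite /btw.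
  by rewrite (metric_sym w); lra.
have := MP w' w (conj (Ax_sub_axis g0 gA gw') (Ax_sub_axis h0 hB hw'))
  (conj (Ax_sub_axis g0 gA gw) (Ax_sub_axis h0 hB hw)).
by rewrite -e Ax_exp// leNgt nP.
Qed.

Lemma tl_gt0_btw g x : x <> gact g x -> btw x (gact g x) (gact g (gact g x)) -> 0 < tl g.
Proof. by move=> /eqP h /tl_btw ->; rewrite mdist_gt0. Qed.

Lemma tl_eq0_fix g : tl g = 0 -> exists x, gact g x = x.
Proof.
have [x gx] := Ax_nonempty T g => g0; exists x; apply/esym/mdist_positivity.
by rewrite gx.
Qed.

(* Let [r] be the point where [q, c] and [q, b c] part; it is fixed by [b].  With
   A = a^(n+1) and w = A b, the orbit of [c] under [w] runs through
   c, A c, A r, w c, w A c, ... without backtracking. *)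
Lemma tl_mul_fix_off_axis a b q c n : 0 < tl a -> gact b q = q -> Ax a c ->
  (forall z, Ax a z -> btw q c z) -> gact b c <> c -> 0 < tl (a ^+ n.+1 * b)%g.
Proof.
move=> a0 bq ac cP bc.
have [r [qr1 qr2 cr]] := median T4 Tg q c (gact b c).
have br : gact b r = r.
  apply: (btw_uniq T4 _ qr2); last by rewrite -{1}bq gact_isometry.
  by rewrite -{1}bq; exact: ((gact_btw _ _ _ _).1 qr1).
have rc : r <> c by move=> e; apply: bc; rewrite -e br.
have rbc : gact b c <> r by rewrite -{1}br => /gact_inj/esym.
have rP z : Ax a z -> btw r c z by move=> az; exact: btw_transr (cP z az) qr1.
pose A := (a ^+ n.+1)%g; pose w := (A * b)%g.
have aA z : Ax a z -> Ax a (gact A z) by exact: Ax_expg.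
have aAV z : Ax a z -> Ax a (gact A^-1%g z).
  by rewrite /A -expVgn -AxV => hy; exact: Ax_expg.
have cAc : c <> gact A c.
  move=> e; have := @Ax_exp_neq _ _ T a c 0 n.+1 a0 ac isT.
  by rewrite expg0 gact1; apply.
have c1 : btw c (gact A c) (gact A r).
  apply: (gact_btw A^-1%g _ _ _).2; rewrite !gactK; exact/btw_sym/rP/aAV.
have c2 : btw (gact A c) (gact A r) (gact w c).
  by rewrite /w gactM; exact: ((gact_btw _ _ _ _).1 cr).
have Acr : gact A c <> gact A r.
  by move/gact_inj/esym.
have [d1 d2] := btw_chain T4 c1 c2 Acr.
have c3 : btw (gact A r) (gact w c) (gact w (gact A c)).
  rewrite /w !gactM; apply: (gact_btw A _ _ _).1.
  by rewrite -{1}br; apply: (gact_btw b _ _ _).1; exact/rP/aA.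
have Arw : gact A r <> gact w c.
  by rewrite /w gactM => /gact_inj/esym.
have [_ d3] := btw_chain T4 d2 c3 Arw.
have c4 : btw (gact w c) (gact w (gact A c)) (gact w (gact w c)).
  exact: ((gact_btw w _ _ _).1 d1).
have wcA : gact w c <> gact w (gact A c).
  by move/gact_inj.
have [d4 _] := btw_chain T4 d3 c4 wcA.
apply: tl_gt0_btw d4 => e; apply: cAc; apply: mdist_positivity.
move: d1; rewrite /btw -e mdistxx => h; apply/eqP; rewrite eq_le mdist_ge0 andbT.
by have := mdist_ge0 (gact A c) c; lra.
Qed.

(** The last hypothesis says that [b] does not turn the forward direction of the axis at [p] into
    the backward one; this keeps the orbit of [p] under [a^(n+1) b] from backtracking. *)
Lemma tl_mul_fix_on_axis a b p n : 0 < tl a -> Ax a p -> gact b p = p ->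
  btw (gact a^-1%g p) p (gact b (gact a p)) -> 0 < tl (a ^+ n.+1 * b)%g.
Proof.
move=> a0 ap bp h; pose A := (a ^+ n.+1)%g.
have pap : p <> gact a p by apply/eqP; rewrite -mdist_gt0 ap.
have p1 : btw p (gact a p) (gact A p).
  rewrite /btw /A expgS gactM gact_isometry ap (Ax_exp _ ap) -gactM -expgS.
  by rewrite (Ax_exp _ ap) -natr1 mulrDl mul1r addrC.
have p2 : btw p (gact a^-1%g p) (gact A^-1%g p).
  have := ap; rewrite -AxV => ap'; rewrite /A -expVgn.
  rewrite /btw expgS gactM gact_isometry ap' (Ax_exp _ ap') -gactM -expgS.
  by rewrite (Ax_exp _ ap') -natr1 mulrDl mul1r addrC.
have pbap : p <> gact b (gact a p).
  by rewrite -{1}bp => /gact_inj.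
have pVap : gact a^-1%g p <> p.
  by move=> e; apply: pap; rewrite -{2}e gactKV.
have c1 : btw p (gact b (gact a p)) (gact b (gact A p)).
  by rewrite -{1}bp; exact: ((gact_btw _ _ _ _).1 p1).
have [_ d1] := btw_chain T4 (btw_sym p2) h pVap.
have [d2 _] := btw_chain T4 d1 c1 pbap.
apply: (@tl_gt0_btw _ p); rewrite gactM bp.
  move=> e; have := @Ax_exp_neq _ _ T a p 0 n.+1 a0 ap isT.
  by rewrite expg0 gact1; apply.
rewrite gactM; apply: (gact_btw A^-1%g _ _ _).2; rewrite !gactK.
exact: d2.
Qed.

(** When [b] fixes the gate [c], either [b] or [b^2] will do: if both turned the forward direction
    at [c] into the backward one, [b] would fix the backward direction, hence could not send the
    forward one to it. *)
Lemma elliptic_mul a b : 0 < tl a -> tl b = 0 ->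
  exists k : nat, forall n, 0 < tl (a ^+ n.+1 * b ^+ k.+1)%g.
Proof.
move=> a0 b0; have [q bq] := tl_eq0_fix b0; have [c ac cP] := Ax_gate q a0.
have [bc|/eqP bc] := eqVneq (gact b c) c; last first.
  by exists 0%N => n; rewrite expg1; exact: (tl_mul_fix_off_axis _ a0 bq ac cP bc).
have [h|h1] := pselect (btw (gact a^-1%g c) c (gact b (gact a c))).
  by exists 0%N => n; rewrite expg1; exact: tl_mul_fix_on_axis a0 ac bc h.
exists 1%N => n; apply: (tl_mul_fix_on_axis _ a0 ac); rewrite expg2 gactM ?bc//.
apply: contrapT => h2.
have ac' : d c (gact a c) = tl a := ac.
have l1 : d c (gact b (gact a c)) = tl a by rewrite -{1}bc gact_isometry.
have l2 : d c (gact b (gact b (gact a c))) = tl a.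
  by rewrite -{1}bc gact_isometry.
have lV : d (gact a^-1%g c) c = tl a by rewrite gact_mdistl invgK.
have Va : d (gact a^-1%g c) (gact a c) = tl a + tl a.
  have := Ax_btw_exp 1 ac; rewrite expg1 /btw => <-.
  by rewrite lV ac'.
have e12 : d (gact b (gact a c)) (gact b (gact b (gact a c))) =
    d (gact a c) (gact b (gact a c)) by exact: gact_isometry.
have n1 : d (gact a^-1%g c) (gact b (gact a c)) < tl a + tl a.
  rewrite lt_neqAle; apply/andP; split.
    by apply/eqP => e; apply: h1; rewrite /btw lV l1.
  by rewrite -{1}lV -l1; exact: metric_triangle.
have n2 : d (gact a^-1%g c) (gact b (gact b (gact a c))) < tl a + tl a.
  rewrite lt_neqAle; apply/andP; split.
    by apply/eqP => e; apply: h2; rewrite /btw lV l2.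
  by rewrite -{1}lV -l2; exact: metric_triangle.
move: (gact b (gact b (gact a c))) l2 e12 n2 {h2} => f2 l2 e12 n2.
move: (gact b (gact a c)) l1 e12 n1 {h1} => f1 l1 e12 n1.
(* The first condition gives [d f1 f2 < 2 tl a], which is also the distance from [a c] to [f1]; the
   second then contradicts that [c] is the midpoint of [a^-1 c] and [a c]. *)
have := T4 f1 f2 (gact a^-1%g c) c; have := T4 (gact a^-1%g c) (gact a c) f1 c.
rewrite e12 lV Va.
rewrite (metric_sym f1 c) (metric_sym f2 c) (metric_sym (gact a c) c).
rewrite (metric_sym f1 (gact a^-1%g c)) (metric_sym f2 (gact a^-1%g c)) l1 l2 ac'.
by move=> [] h1 [] h2; lra.
Qed.

End Irreducible.

(** * A common base point *)

(** Among the five indices 0 to 4, one of [P] and [Q] would hold three times. *)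
Lemma no_common_cover (P Q : nat -> Prop) :
  (forall n, P n \/ Q n) ->
  (forall i j k, i != j -> i != k -> j != k -> P i -> P j -> ~ P k) ->
  (forall i j k, i != j -> i != k -> j != k -> Q i -> Q j -> ~ Q k) -> False.
Proof.
move=> H HP HQ.
have [h0|h0] := H 0%N; have [h1|h1] := H 1%N; have [h2|h2] := H 2;
  have [h3|h3] := H 3; have [h4|h4] := H 4;
  first [ by apply: (HP _ _ _ _ _ _ h0 h1 h2) | by apply: (HP _ _ _ _ _ _ h0 h1 h3)
        | by apply: (HP _ _ _ _ _ _ h0 h1 h4) | by apply: (HP _ _ _ _ _ _ h0 h2 h3)
        | by apply: (HP _ _ _ _ _ _ h0 h2 h4) | by apply: (HP _ _ _ _ _ _ h0 h3 h4)
        | by apply: (HP _ _ _ _ _ _ h1 h2 h3) | by apply: (HP _ _ _ _ _ _ h1 h2 h4)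
        | by apply: (HP _ _ _ _ _ _ h1 h3 h4) | by apply: (HP _ _ _ _ _ _ h2 h3 h4)
        | by apply: (HQ _ _ _ _ _ _ h0 h1 h2) | by apply: (HQ _ _ _ _ _ _ h0 h1 h3)
        | by apply: (HQ _ _ _ _ _ _ h0 h1 h4) | by apply: (HQ _ _ _ _ _ _ h0 h2 h3)
        | by apply: (HQ _ _ _ _ _ _ h0 h2 h4) | by apply: (HQ _ _ _ _ _ _ h0 h3 h4)
        | by apply: (HQ _ _ _ _ _ _ h1 h2 h3) | by apply: (HQ _ _ _ _ _ _ h1 h2 h4)
        | by apply: (HQ _ _ _ _ _ _ h1 h3 h4) | by apply: (HQ _ _ _ _ _ _ h2 h3 h4)].
Qed.

Section CommonElements.
Context {R : realType} {G : groupType}.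
Variables T1 T2 : Gtree R G.
Implicit Types (g h u v a b : G).

Notation tl := translation_length.

(** [elliptic_mul] prescribes only the exponent of the elliptic factor. As [a] is elliptic in one
    tree and [b] in the other, both prescriptions can be met at once. *)
Lemma common_hyperbolic a b : 0 < tl T1 a -> 0 < tl T2 b ->
  exists u, 0 < tl T1 u /\ 0 < tl T2 u.
Proof.
move=> a0 b0.
have := tl_ge0 T2 a; rewrite le_eqVlt => /orP[/eqP/esym a2|]; last by exists a.
have := tl_ge0 T1 b; rewrite le_eqVlt => /orP[/eqP/esym b1|]; last by exists b.
have [m mP] := elliptic_mul a0 b1; have [n nP] := elliptic_mul b0 a2.
by exists (a ^+ n.+1 * b ^+ m.+1)%g; split; rewrite // tlC.
Qed.

Lemma common_disjoint_axes : irreducible_action T1 -> irreducible_action T2 ->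
  exists u v, [/\ 0 < tl T1 u, 0 < tl T2 u, 0 < tl T1 v, 0 < tl T2 v &
    disjoint_axes T1 u v /\ disjoint_axes T2 u v].
Proof.
move=> /irreducible_disjoint_axes[a1 [b1 [a10 b10 ab1]]].
move=> /irreducible_disjoint_axes[a2 [b2 [a20 b20 ab2]]].
have [u [u1 u2]] := common_hyperbolic a10 a20.
have [v1 v10 uv1] := exists_disjoint_axis u1 a10 b10 ab1.
have [v2 v20 uv2] := exists_disjoint_axis u2 a20 b20 ab2.
(* [v1] controls [T1] from the left and [v2] controls [T2] from the right, each excluding at most
   two [n]. Conjugating [u] keeps it hyperbolic in both trees. *)
have [n [h1 h2]] : exists n, ~ meets_axis T1 u (v1 * u ^+ n * v2)%g /\
    ~ meets_axis T2 u (v1 * u ^+ n * v2)%g.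
  apply: contrapT => /forallNP H.
  apply: (@no_common_cover (fun n => meets_axis T1 u (v1 * u ^+ n * v2)%g)
      (fun n => meets_axis T2 u (v1 * u ^+ n * v2)%g)).
  - by move=> n; have /not_andP[/contrapT|/contrapT] := H n; [left|right].
  - by move=> i j k ij ik jk; exact: meets_axis_left.
  - by move=> i j k ij ik jk; exact: meets_axis_right.
exists u, (v1 * u ^+ n * v2 * u * (v1 * u ^+ n * v2)^-1)%g.
by split; rewrite ?tl_conj//; split; exact: disjoint_axes_conj.
Qed.

End CommonElements.

(** * Tripods, and displacements read off from translation lengths *)

Section Tripod.
Context {R : realType} {G : groupType}.
Variable T : Gtree R G.
Implicit Types (g h : G) (x y z : T).

Let T4 : fourpt T := @gtree_fourpt _ _ T.

Notation tl := (translation_length T).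
Notation d := mdist.

(* Three elements whose axes are joined to [p] by segments [p, f i] of length
   [r i] that meet only at [p]. *)
Record tripod (v : 'I_3 -> G) (p : T) (f : 'I_3 -> T) (r : 'I_3 -> R) : Prop := {
  tripod_tl : forall i, 0 < tl (v i);
  tripod_Ax : forall i, Ax (v i) (f i);
  tripod_r : forall i, 0 < r i;
  tripod_dist : forall i, d p (f i) = r i;
  tripod_legs : forall i j, i != j -> d (f i) (f j) = r i + r j;
  tripod_foot : forall i y, Ax (v i) y -> btw y (f i) p }.

Lemma tripod_btw v p f r y : tripod v p f r ->
  exists i0, forall i, i != i0 -> btw (f i) p y.
Proof.
move=> tr.
have [[i0 h0]|] := pselect (exists i0, ~ btw (f i0) p y); last first.
  by move=> /forallNP h; exists ord0 => i _; exact: contrapT (h i).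
exists i0 => i ii0.
have h1 : d (f i0) y < d (f i0) p + d p y.
  rewrite lt_neqAle metric_triangle andbT; apply/eqP => e; apply: h0.
  by rewrite /btw e.
apply: btw_le; have := T4 (f i) (f i0) p y.
rewrite (tripod_legs tr ii0) (metric_sym (f i) p) (tripod_dist tr).
move: h1; rewrite (metric_sym (f i0) p) (tripod_dist tr).
by move=> h1 [] h2; lra.
Qed.

Lemma tripod_tl_le v p f r g i k : tripod v p f r ->
  tl (v i * (g * v k * g^-1))%g <=
  tl (v i) + tl (v k) + 2 * (r i + d p (gact g p) + r k).
Proof.
move=> tr; have Ai := tripod_Ax tr i.
have Ak : Ax (g * v k * g^-1)%g (gact g (f k)) by apply/AxJ; exact: tripod_Ax tr k.
have := tl_mul_le Ai Ak; rewrite tl_conj.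
have := metric_triangle (f i) p (gact g (f k)).
have := metric_triangle p (gact g p) (gact g (f k)).
rewrite gact_isometry (metric_sym (f i) p) !(tripod_dist tr); lra.
Qed.

(** [i0] is the leg heading for [gp]; once [i] is chosen, [k0] is the translated leg heading back
    for [f i]. Otherwise [f i], [p], [gp], [g (f k)] follow each other on a geodesic, and it is the
    bridge between the two axes. *)
Lemma tripod_tl_eq v p f r g : tripod v p f r ->
  exists i0, forall i, i != i0 -> exists k0, forall k, k != k0 ->
  tl (v i * (g * v k * g^-1))%g =
  tl (v i) + tl (v k) + 2 * (r i + d p (gact g p) + r k).
Proof.
move=> tr; have [i0 i0P] := tripod_btw (gact g p) tr; exists i0 => i /i0P b1.
have [k0 k0P] := tripod_btw (gact g^-1%g (f i)) tr; exists k0 => k /k0P b2.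
have b3 := (gact_btw g _ _ _).1 b2; rewrite gactKV in b3.
have b4 : btw (gact g (f k)) p (f i).
  exact: btw_sym (btw_trans (btw_sym b3) b1).
have b5 : btw (f i) (gact g p) (gact g (f k)) := btw_sym b3.
have Ai := tripod_Ax tr i.
have Ak : Ax (g * v k * g^-1)%g (gact g (f k)) by apply/AxJ; exact: tripod_Ax tr k.
have fi : f i <> p.
  by apply/eqP; rewrite -mdist_gt0 metric_sym (tripod_dist tr) (tripod_r tr).
have fk : gact g (f k) <> gact g p.
  apply/eqP; rewrite -mdist_gt0 gact_isometry metric_sym (tripod_dist tr).
  exact: tripod_r tr k.
have footi y : Ax (v i) y -> btw y (f i) (gact g (f k)).
  move=> Ay; have [] := btw_chain T4 (tripod_foot tr Ay) (btw_sym b4) fi.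
  by [].
have footk y : Ax (g * v k * g^-1)%g y -> btw y (gact g (f k)) (f i).
  move=> Ay; have Ay' : Ax (v k) (gact g^-1%g y).
    by apply: (AxJ _ g _).1; rewrite gactKV.
  have := (gact_btw g _ _ _).1 (tripod_foot tr Ay'); rewrite gactKV => b6.
  by have [] := btw_chain T4 b6 (btw_sym b5) fk.
have e : d (f i) (gact g (f k)) = r i + d p (gact g p) + r k.
  rewrite -b5 -b1 gact_isometry (tripod_dist tr) (metric_sym (f i)).
  by rewrite (tripod_dist tr).
rewrite -e (@tl_mul_bridge _ _ T (v i) (g * v k * g^-1)%g (f i)
  (gact g (f k))) ?tl_conj//.
- move=> e0; have := tripod_r tr i; have := tripod_r tr k.
  have := mdist_ge0 p (gact g p); move: e; rewrite e0 mdistxx; lra.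
- exact/footi/Ax_gactV.
- exact/btw_sym/footk/Ax_gact1.
- exact/footk/Ax_gactV.
- exact/btw_sym/footi/Ax_gact1.
- exact: tripod_tl tr i.
- exact: tripod_tl tr k.
Qed.

Definition tripod_shift (u : G) (i : 'I_3) : G := nth 1%g [:: 1%g; u; u^-1%g] i.

(** The first leg is the bridge; the other two follow the axis of [u] for one period before a
    translate of the bridge. The leg lengths are linear in translation lengths, so they add up when
    the length functions do. *)
Lemma bridge_tripod (u v : G) : 0 < tl u -> 0 < tl v -> disjoint_axes T u v ->
  exists p f, tripod
    (fun i => tripod_shift u i * v * (tripod_shift u i)^-1)%g p f
    (fun i => (tl (u * v)%g - tl u - tl v) / 2 + (if i == ord0 then 0 else tl u)).
Proof.
move=> u0 v0 uv; have [p [q [up vq pq h]]] := bridge u0 v0 uv.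
have -> : (tl (u * v)%g - tl u - tl v) / 2 = d p q.
  by rewrite (bridge_tl u0 v0 up vq pq h); lra.
have [h1 h2] := bridge_btw up vq h.
have b0 z y : Ax u z -> Ax v y -> btw z q y.
  by move=> uz vy; rewrite /btw (h z y)// (h z q)// mdistxx addr0.
have D0 : 0 < d p q by rewrite mdist_gt0; apply/eqP.
have uA i : Ax u (gact (tripod_shift u i)^-1%g p).
  case: i => -[|[|[|//]]] lt; rewrite /tripod_shift /= ?invg1 ?gact1 ?invgK//.
    exact: Ax_gactV.
  exact: Ax_gact1.
have long g : Ax u (gact g p) -> Ax u (gact g^-1%g p) -> p <> gact g p ->
    d q (gact g q) = d p q + d p (gact g p) + d p q.
  move=> gp gVp pgp; have c1 := btw_sym (h1 _ gp).
  have c2 : btw p (gact g p) (gact g q).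
    by apply: (gact_btw g^-1%g _ _ _).2; rewrite !gactK; exact: h1.
  have [_ <-] := btw_chain T4 c1 c2 pgp.
  by rewrite -c1 gact_isometry (metric_sym q).
have pup : p <> gact u p by apply/eqP; rewrite -mdist_gt0 up.
have d1 : d q (gact u q) = d p q + tl u + d p q.
  by rewrite long ?up//; [exact: Ax_gact1|exact: Ax_gactV].
have d2 : d q (gact (u * u)%g q) = d p q + (tl u + tl u) + d p q.
  have e : d p (gact (u * u)%g p) = tl u + tl u.
    by have := Ax_exp 2 up; rewrite expg2 => ->; rewrite mulr_natl mulr2n.
  rewrite long ?e//.
  - by rewrite gactM; exact/Ax_gact1/Ax_gact1.
  - by rewrite invgM gactM; exact/Ax_gactV/Ax_gactV.
  - by apply/eqP; rewrite -mdist_gt0 e addr_gt0.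
exists p, (fun i => gact (tripod_shift u i) q); split.
- by move=> i; rewrite tl_conj.
- by move=> i; apply/AxJ.
- by move=> i; case: ifP => _; rewrite ?addr0// addr_gt0.
- case=> -[|[|[|//]]] /= lt; rewrite /tripod_shift /=.
  + by rewrite gact1 addr0.
  + rewrite metric_sym gact_mdistl metric_sym -(h1 _ (Ax_gactV up)) addrC.
    by rewrite gact_mdistl invgK up.
  + rewrite metric_sym gact_mdistl invgK metric_sym -(h1 _ (Ax_gact1 up)) addrC.
    by rewrite (metric_sym (gact u p)) up.
- case=> -[|[|[|//]]] /= lt [] [|[|[|//]]] /= lt' //; rewrite /tripod_shift /= => _.
  + by rewrite gact1 d1 addr0; lra.
  + by rewrite gact1 addr0 metric_sym gact_mdistl invgK d1; lra.
  + by rewrite gact1 metric_sym d1 addr0; lra.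
  + by rewrite metric_sym gact_mdistl invgK -gactM d2; lra.
  + by rewrite gact1 addr0 gact_mdistl invgK d1; lra.
  + by rewrite gact_mdistl invgK -gactM d2; lra.
- move=> i y Ay; apply: (gact_btw (tripod_shift u i)^-1%g _ _ _).2; rewrite gactK.
  apply/btw_sym/b0; first exact: uA.
  by apply: (AxJ _ (tripod_shift u i) _).1; rewrite gactKV.
Qed.

End Tripod.

Lemma exists_ord3_neq (a b : 'I_3) : exists c : 'I_3, c != a /\ c != b.
Proof.
have : ~~ ([set: 'I_3] \subset [set a; b])%SET.
  apply/negP => /subset_leq_card; rewrite cardsT card_ord cards2.
  by case: (a != b).
by move=> /subsetPn[c _]; rewrite !inE negb_or => /andP[]; exists c.
Qed.

Section CommonBasePoint.
Context {R : realType} {G : groupType}.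
Variables T1 T2 T : Gtree R G.
Notation tl := translation_length.
Hypothesis tlD : forall g, tl T g = tl T1 g + tl T2 g.

(** Indices good for [T], with the general bound in [T1] and [T2], give one inequality; indices good
    for [T1] and [T2] together, with the bound in [T], give the other. *)
Lemma tripod_base_point v p1 f1 r1 p2 f2 r2 p f r :
  @tripod _ _ T1 v p1 f1 r1 -> @tripod _ _ T2 v p2 f2 r2 -> @tripod _ _ T v p f r ->
  (forall i, r i = r1 i + r2 i) ->
  forall g, mdist p (gact g p) = mdist p1 (gact g p1) + mdist p2 (gact g p2).
Proof.
move=> tr1 tr2 tr rD g.
have [i1 h1] := tripod_tl_eq g tr1; have [i2 h2] := tripod_tl_eq g tr2.
have [i0 h0] := tripod_tl_eq g tr.
apply/eqP; rewrite eq_le; apply/andP; split.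
  have [i [ii0 _]] := exists_ord3_neq i0 i0; have [k0 hk] := h0 i ii0.
  have [k [kk0 _]] := exists_ord3_neq k0 k0; have := hk k kk0.
  have := tripod_tl_le g i k tr1; have := tripod_tl_le g i k tr2.
  rewrite !tlD !rD; lra.
have [i [ii1 ii2]] := exists_ord3_neq i1 i2.
have [k1 hk1] := h1 i ii1; have [k2 hk2] := h2 i ii2.
have [k [kk1 kk2]] := exists_ord3_neq k1 k2.
have := hk1 k kk1; have := hk2 k kk2; have := tripod_tl_le g i k tr.
rewrite !tlD !rD; lra.
Qed.

Lemma common_base_point : irreducible_action T1 -> irreducible_action T2 ->
  exists (p1 : T1) (p2 : T2) (p : T), forall g,
    mdist p (gact g p) = mdist p1 (gact g p1) + mdist p2 (gact g p2).
Proof.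
move=> irr1 irr2.
have [u [v [u1 u2 v1 v2 [uv1 uv2]]]] := common_disjoint_axes irr1 irr2.
have big (T' : Gtree R G) : 0 < tl T' u -> 0 < tl T' v -> disjoint_axes T' u v ->
    tl T' u + tl T' v < tl T' (u * v)%g.
  move=> u0 v0 uv; have [p [q [up vq pq h]]] := bridge u0 v0 uv.
  rewrite (bridge_tl u0 v0 up vq pq h) ltrDl mulr_gt0// mdist_gt0.
  exact/eqP.
have b1 := big _ u1 v1 uv1; have b2 := big _ u2 v2 uv2.
have uv : disjoint_axes T u v by apply: disjoint_axes_tl; rewrite !tlD; lra.
have u0 : 0 < tl T u by rewrite tlD addr_gt0.
have v0 : 0 < tl T v by rewrite tlD addr_gt0.
have [p1 [f1 tr1]] := bridge_tripod u1 v1 uv1.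
have [p2 [f2 tr2]] := bridge_tripod u2 v2 uv2.
have [p [f tr]] := bridge_tripod u0 v0 uv.
exists p1, p2, p; apply: (tripod_base_point tr1 tr2 tr) => i.
by rewrite !tlD; case: ifP => _; lra.
Qed.

End CommonBasePoint.

(** * Translation lengths in a common refinement *)

(** A monotone function that skips no value has no jump. Alignment-preserving maps are not assumed
    continuous; this yields the continuity along geodesics that the intermediate value theorem
    needs. *)
Lemma monotone_onto_continuous (R : realType) (L : R) (f : R -> R) :
  (forall s t, 0 <= s -> s <= t -> t <= L -> f s <= f t) ->
  (forall v, f 0 <= v <= f L -> exists2 t, 0 <= t <= L & f t = v) ->
  {within `[0, L], continuous f}.
Proof.
move=> fm fs; apply/(@within_continuous_path R R^o) => s /=.
rewrite in_itv /= => /andP[s0 sL] e e0.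
have f0s := fm 0 s (lexx _) s0 sL; have fsL := fm s L s0 sL (lexx _).
have [r r0 rP] : exists2 r, 0 < r &
    forall t, t <= L -> s <= t -> t - s < r -> f t < f s + e.
  have [h|h] := leP (f L) (f s + e / 2).
    by exists 1 => // t tL st _; have := fm t L (le_trans s0 st) tL (lexx _); lra.
  have [|t1 /andP[t10 t1L] ft1] := fs (f s + e / 2).
    by apply/andP; split; lra.
  exists (t1 - s) => [|t tL st h1].
    rewrite subr_gt0 ltNge; apply/negP => h1.
    have := fm t1 s t10 h1 sL; lra.
  have := fm t t1 (le_trans s0 st); rewrite ft1 => /(_ _ t1L) h2.
  have : f t <= f s + e / 2 by apply: h2; lra.
  lra.
have [l l0 lP] : exists2 l, 0 < l &
    forall t, 0 <= t -> t <= s -> s - t < l -> f s - e < f t.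
  have [h|h] := leP (f s - e / 2) (f 0).
    by exists 1 => // t t0 ts _; have := fm 0 t (lexx _) t0 (le_trans ts sL); lra.
  have [|t1 /andP[t10 t1L] ft1] := fs (f s - e / 2).
    by apply/andP; split; lra.
  exists (s - t1) => [|t t0 ts h1].
    rewrite subr_gt0 ltNge; apply/negP => h1.
    have := fm s t1 s0 h1 t1L; lra.
  have := fm t1 t t10; rewrite ft1 => /(_ _ (le_trans ts sL)) h2.
  have : f s - e / 2 <= f t by apply: h2; lra.
  lra.
exists (Num.min l r) => [|t /=]; first by rewrite lt_min l0.
rewrite in_itv /= => /andP[t0 tL]; rewrite lt_min => /andP[hl hr].
rewrite /mdist /= ltr_distl.
have [st|/ltW ts] := leP s t.
  have := fm s t s0 st tL; have := rP t tL st.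
  by move: hr; rewrite distrC ger0_norm ?subr_ge0// => hr /(_ hr) ? ?;
    apply/andP; split; lra.
have := fm t s t0 ts sL; have := lP t t0 ts.
by move: hl; rewrite ger0_norm ?subr_ge0// => hl /(_ hl) ? ?;
  apply/andP; split; lra.
Qed.

Section Alignment.
Context {R : realType} {G : groupType}.
Variables T T' : Gtree R G.
Variable f : T -> T'.
Hypothesis fa : preserves_alignment f.

Lemma alignment_btw a b c : btw a b c -> btw (f a) (f b) (f c).
Proof.
move=> /(segmentE (@gtree_geodesic _ _ T)) h.
apply/(segmentE (@gtree_geodesic _ _ T')); rewrite -fa.
by exists b.
Qed.

Lemma alignment_path_continuous a b c : geodesic_path a b c ->
  {within `[0, mdist a b], continuous (fun t => mdist (f a) (f (c t)))}.
Proof.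
move=> gc; have [c0 c1 ci] := gc.
have mono s t : 0 <= s -> s <= t -> t <= mdist a b -> btw a (c s) (c t).
  move=> s0 st tL.
  have s1 : 0 <= s <= mdist a b by rewrite s0 (le_trans st).
  have t1 : 0 <= t <= mdist a b by rewrite tL (le_trans s0).
  have [e1 _] := geodesic_pathE gc s1; have [e2 _] := geodesic_pathE gc t1.
  rewrite /btw e1 e2 ci ?in_itv//.
  by rewrite ler0_norm ?subr_le0// opprB addrC subrK.
apply: monotone_onto_continuous => [s t s0 st tL|v].
  by rewrite -(alignment_btw (mono s t s0 st tL)) lerDl mdist_ge0.
rewrite c0 c1 mdistxx => vL.
have [w aw dw] := btw_point (@gtree_geodesic _ _ T') vL.
have : segment (f a) (f b) w by apply/(segmentE (@gtree_geodesic _ _ T')).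
rewrite -fa => -[m /(segmentE (@gtree_geodesic _ _ T)) amb fm].
have dm : 0 <= mdist a m <= mdist a b.
  by rewrite mdist_ge0 -amb lerDl mdist_ge0.
exists (mdist a m) => //; rewrite -dw -fm; congr (mdist _ (f _)).
have [e1 _] := geodesic_pathE gc dm.
exact: (btw_uniq (@gtree_fourpt _ _ T) (geodesic_path_btw gc dm) amb e1).
Qed.

End Alignment.

Section CommonRefinement.
Context {R : realType} {G : groupType}.
Variables T1 T2 T0 : Gtree R G.
Variables (f1 : T0 -> T1) (f2 : T0 -> T2).
Hypothesis f1a : preserves_alignment f1.
Hypothesis f2a : preserves_alignment f2.
Implicit Types x y z w m : T0.

Let F x := (f1 x, f2 x).
Let D x y := l1dist (F x) (F y).

Let D_btw x m y : btw x m y -> D x m + D m y = D x y.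
Proof.
move=> h; have := alignment_btw f1a h; have := alignment_btw f2a h.
by rewrite /btw /D /l1dist /= => <- <-; lra.
Qed.

Let D_sym x y : D x y = D y x.
Proof. by rewrite /D /l1dist /= metric_sym (metric_sym (f2 x)). Qed.

Let D_tri x y z : D x z <= D x y + D y z.
Proof.
rewrite /D /l1dist /=; have := metric_triangle (f1 x) (f1 y) (f1 z).
have := metric_triangle (f2 x) (f2 y) (f2 z); lra.
Qed.

(** [D] is additive along the segments of [T0], so medians of [T0] serve for [D] and the argument of
    [Rtree_fourpt] applies. *)
Lemma refinement_l1_fourpt : l1_fourpt (range F).
Proof.
move=> _ _ _ _ [x _ <-] [y _ <-] [z _ <-] [w _ <-].
rewrite -!/(D _ _).
have [m [h1 h2 h3]] := median (@gtree_fourpt _ _ T0) (@gtree_geodesic _ _ T0) x y z.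
have k1 := D_btw h1; have k2 := D_btw h2; have k3 := D_btw h3.
have t1 := D_tri w m x; have t2 := D_tri w m y; have t3 := D_tri w m z.
have o (a b : T0) : btw a m b -> D a m + D m w = D a w \/ D b m + D m w = D b w.
  by case/(btw_or (@gtree_fourpt _ _ T0) w) => /D_btw; [left|right].
have := o _ _ h1; have := o _ _ h2; have := o _ _ h3.
have s1 := D_sym m w; have s2 := D_sym m x; have s3 := D_sym m y.
have s4 := D_sym m z; have s5 := D_sym w x; have s6 := D_sym w y.
have s7 := D_sym w z; have s8 := D_sym y z; have s9 := D_sym x z.
by move=> [] o1 [] o2 [] o3; lra.
Qed.

Lemma refinement_l1_geodesic : l1_geodesic (range F).
Proof.
move=> _ _ s [x _ <-] [y _ <-]; rewrite -/(D x y) => sD.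
have [c gc] := @gtree_geodesic _ _ T0 x y; have [c0 c1 _] := gc.
have cc : {within `[0, mdist x y], continuous (fun t => D x (c t))}.
  exact: (within_continuousD (alignment_path_continuous f1a gc)
    (alignment_path_continuous f2a gc)).
have D0 : D x (c 0) = 0 by rewrite c0 /D /l1dist !mdistxx addr0.
have [|t tL e] := @IVT _ _ _ _ s (mdist_ge0 x y) cc.
  rewrite D0 c1; case/andP: sD => s0 sD.
  by rewrite min_l ?max_r ?s0 ?(le_trans s0).
rewrite in_itv /= in tL.
have := geodesic_path_btw gc tL => /D_btw h.
exists (F (c t)); split; first by exists (c t).
  exact: e.
by rewrite -/(D _ _) -h e addrC addKr.
Qed.

End CommonRefinement.

Section TranslationLengthSum.
Context {R : realType} {G : groupType}.
Variables T T1 T2 : Gtree R G.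
Variables (f1 : T -> T1) (f2 : T -> T2).

Lemma tl_l1 g : equivariant f1 -> equivariant f2 ->
  (forall x y, mdist x y = mdist (f1 x) (f1 y) + mdist (f2 x) (f2 y)) ->
  translation_length T g = translation_length T1 g + translation_length T2 g.
Proof.
move=> e1 e2 fd; have [[x _] _ _] := gtree_Rtree T.
have [C CP] := tl_asymptotic g x.
have [C1 CP1] := tl_asymptotic g (f1 x); have [C2 CP2] := tl_asymptotic g (f2 x).
have H n : `|n%:R * (translation_length T g -
    (translation_length T1 g + translation_length T2 g))| <= C + C1 + C2.
  move: (CP n) (CP1 n) (CP2 n); rewrite fd e1 e2 !ler_norml mulrBr mulrDr.
  by move=> /andP[? ?] /andP[? ?] /andP[? ?]; apply/andP; split; lra.
apply/eqP; rewrite -subr_eq0 eq_le; apply/andP; split.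
  apply: (@mulrn_bounded_le0 _ _ (C + C1 + C2)) => n.
  exact: le_trans (ler_norm _) (H n).
rewrite -oppr_le0; apply: (@mulrn_bounded_le0 _ _ (C + C1 + C2)) => n.
by rewrite mulrN; apply: le_trans (ler_norm _) _; rewrite normrN.
Qed.

End TranslationLengthSum.

Lemma compatible_length_function (R : realType) (G : groupType) (T1 T2 : Gtree R G) :
  compatible T1 T2 ->
  length_function (fun g : G => translation_length T1 g + translation_length T2 g).
Proof.
move=> [T0 [f1 [f2 [e1 a1 e2 a2]]]].
have [||||T [h1 [h2 [[k1 _ k2 _] hd _]]]] :=
  @l1_tree R G T1 T2 (range (fun x => (f1 x, f2 x))).
- by have [[x _] _ _] := gtree_Rtree T0; exists (f1 x, f2 x), x.
- by move=> g _ [x _ <-] /=; exists (gact g x) => //; rewrite e1 e2.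
- exact: refinement_l1_fourpt.
- exact: refinement_l1_geodesic.
by exists T => g; rewrite (tl_l1 g k1 k2 hd).
Qed.

(** * Interpolation along the orbit of the base point *)

Section Isosceles.
Context {R : realType}.

(* The smallest of [a], [b], [c] is attained twice. *)
Definition isosceles (a b c : R) :=
  [/\ a <= b \/ c <= b, b <= a \/ c <= a & a <= c \/ b <= c].

Lemma isosceles_swap a b c : isosceles a b c -> isosceles a c b.
Proof. by case=> x y z; split; [exact: z|case: y; auto|exact: x]. Qed.

(** If [a2] and [c2] differed, the smaller would equal [s2]; as [a1 = c1 < s1], the corresponding
    sum would then be a least value attained only once. *)
Lemma isosceles_sum_branch (s1 a1 c1 s2 a2 c2 : R) :
  isosceles s1 a1 c1 -> isosceles s2 a2 c2 ->
  isosceles (s1 + s2) (a1 + a2) (c1 + c2) ->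
  a1 < s1 -> a1 = c1 /\ a2 = c2.
Proof.
move=> [x1 y1 z1] [x2 y2 z2] [x y z] sa.
have e1 : a1 = c1 by case: x1 => h1; case: z1 => h2; lra.
split=> //; move: sa x y z; rewrite {}e1 => sa x y z.
have [ac|ca|//] := ltgtP a2 c2.
  by case: x2 => h1; case: y2 => h2; case: x => h3; lra.
by case: z2 => h1; case: y2 => h2; case: z => h3; lra.
Qed.

End Isosceles.

(** * Gromov products of orbit points *)

Section OrbitProducts.
Context {R : realType} {G : groupType}.
Variables (T : Gtree R G) (p : T).
Implicit Types g h k l : G.

Let T4 : fourpt T := @gtree_fourpt _ _ T.

Definition odist g h : R := mdist (gact g p) (gact h p).

(** The Gromov product of [hp] and [kp] at [gp]: the position on [[gp, hp]] at which the way to [kp]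
    branches off. *)
Definition oprod g h k : R := (odist g h + odist g k - odist h k) / 2.

Lemma odist_sym g h : odist g h = odist h g.
Proof. exact: metric_sym. Qed.

Lemma odistgg g : odist g g = 0.
Proof. exact: mdistxx. Qed.

Lemma odist_shift k g h : odist (k * g)%g (k * h)%g = odist g h.
Proof. by rewrite /odist !gactM gact_isometry. Qed.

Lemma oprod_shift l g h k : oprod (l * g)%g (l * h)%g (l * k)%g = oprod g h k.
Proof. by rewrite /oprod !odist_shift. Qed.

Lemma oprod_sym g h k : oprod g h k = oprod g k h.
Proof. by rewrite /oprod (odist_sym h k) (addrC (odist g h)). Qed.

Lemma oprod_base g h : oprod g h g = 0.
Proof. by rewrite /oprod odistgg addr0 (odist_sym h) subrr mul0r. Qed.

Lemma oprod_end g h : oprod g h h = odist g h.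
Proof. by rewrite /oprod odistgg subr0; lra. Qed.

Lemma oprod_flip g h k : oprod h g k = odist g h - oprod g h k.
Proof. by rewrite /oprod (odist_sym h g); lra. Qed.

Lemma oprod_ge0 g h k : 0 <= oprod g h k.
Proof.
rewrite /oprod; have := metric_triangle (gact h p) (gact g p) (gact k p).
rewrite (metric_sym (gact h p) (gact g p)) -/(odist g h) -/(odist g k).
by rewrite -/(odist h k); lra.
Qed.

Lemma oprod_le g h k : oprod g h k <= odist g h.
Proof. by have := oprod_ge0 h g k; rewrite oprod_flip subr_ge0. Qed.

Lemma oprod_hyp g h k l :
  oprod g h k <= oprod g h l \/ oprod g k l <= oprod g h l.
Proof.
have h0 : odist g k + odist h l <= odist g h + odist k l \/
  odist g k + odist h l <= odist g l + odist k h by exact: T4.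
rewrite /oprod; move: h0; rewrite (odist_sym k h).
by case=> h1; [right|left]; lra.
Qed.

Lemma oprod_hyp3 g h k l :
  isosceles (oprod g h k) (oprod g h l) (oprod g k l).
Proof.
split; first exact: oprod_hyp.
  by have := oprod_hyp g h l k; rewrite (oprod_sym g l k).
by have := oprod_hyp g k h l; rewrite (oprod_sym g k h).
Qed.

End OrbitProducts.

Section Interpolation.
Context {R : realType} {G : groupType}.
Variables (T1 T2 T : Gtree R G) (p1 : T1) (p2 : T2) (p : T).
Hypothesis pD : forall g,
  mdist p (gact g p) = mdist p1 (gact g p1) + mdist p2 (gact g p2).
Implicit Types g h k l : G.

Notation A1 := (oprod p1).
Notation A2 := (oprod p2).
Notation A := (oprod p).

Lemma odistD g h : odist p g h = odist p1 g h + odist p2 g h.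
Proof.
have e (T' : Gtree R G) (q : T') : odist q g h = mdist q (gact (g^-1 * h)%g q).
  by rewrite /odist gact_mdistl gactM.
by rewrite !e pD.
Qed.

Lemma oprodD g h k : A g h k = A1 g h k + A2 g h k.
Proof. by rewrite /oprod !odistD; lra. Qed.

(** If [k] branched off before [l] in one tree and after it in the other, the product of [k] and [l]
    at [g] would be the smaller value in each tree, so its sum would be strictly least, against the
    condition in [T]. *)
Lemma oprod_chain g h k l :
  (A1 g h k <= A1 g h l /\ A2 g h k <= A2 g h l) \/
  (A1 g h l <= A1 g h k /\ A2 g h l <= A2 g h k).
Proof.
have [_ _ hx] := oprod_hyp3 p g h k l; rewrite !oprodD in hx.
have [p1' q1' _] := oprod_hyp3 p1 g h k l.
have [p2' q2' _] := oprod_hyp3 p2 g h k l.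
have [a|a] := leP (A1 g h k) (A1 g h l); have [b|b] := leP (A2 g h k) (A2 g h l).
- by left.
- have [e|a'] := eqVneq (A1 g h k) (A1 g h l); first by right; rewrite e lexx (ltW b).
  exfalso; have {a'}a : A1 g h k < A1 g h l by rewrite lt_neqAle a'.
  by case: q1' => h1; case: p2' => h2; case: hx => h3; lra.
- have [e|b'] := eqVneq (A2 g h k) (A2 g h l); first by right; rewrite e lexx (ltW a).
  exfalso; have {b'}b : A2 g h k < A2 g h l by rewrite lt_neqAle b'.
  by case: p1' => h1; case: q2' => h2; case: hx => h3; lra.
- by right; rewrite !ltW.
Qed.

(* Let [s] be the position at which h' leaves [gp, hp].  The branch points
   below [s] are the same for h and h', and all others lie above [s] in both
   coordinates. *)
Lemma oprod_branch g h h' k :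
  (A1 g h k = A1 g h' k /\ A2 g h k = A2 g h' k) \/
  [/\ A1 g h h' <= A1 g h k, A2 g h h' <= A2 g h k,
      A1 g h h' <= A1 g h' k & A2 g h h' <= A2 g h' k].
Proof.
have i1 := oprod_hyp3 p1 g h h' k; have i2 := oprod_hyp3 p2 g h h' k.
have i := oprod_hyp3 p g h h' k; rewrite !oprodD in i.
have j1 := isosceles_swap i1; have j2 := isosceles_swap i2.
have j := isosceles_swap i.
have [a1|a1] := leP (A1 g h h') (A1 g h k); last first.
  by left; exact: isosceles_sum_branch i1 i2 i a1.
have [c1|c1] := leP (A1 g h h') (A1 g h' k); last first.
  by left; have [-> ->] := isosceles_sum_branch j1 j2 j c1.
have [a2|a2] := leP (A2 g h h') (A2 g h k); last first.
  rewrite ![_ + A2 _ _ _]addrC in i.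
  by left; have [-> ->] := isosceles_sum_branch i2 i1 i a2.
have [c2|c2] := leP (A2 g h h') (A2 g h' k); last first.
  rewrite ![_ + A2 _ _ _]addrC in j.
  by left; have [-> ->] := isosceles_sum_branch j2 j1 j c2.
by right.
Qed.

(** A point at position [t] has coordinates [a] in [T1] and [t - a] in [T2]. It is on the same side
    of the branch point of [k] in both trees when [a] lies between [A1 g h k] and [t - A2 g h k].
    The two fills are the extreme values of [a] that all [k] allow. *)
Definition upper_fill g h t : R :=
  inf [set Num.max (A1 g h k) (t - A2 g h k) | k in [set: G]].

Definition lower_fill g h t : R :=
  sup [set Num.min (A1 g h k) (t - A2 g h k) | k in [set: G]].

(* Between consecutive branch points of [gp, hp], [upper_fill] first follows
   T1 and then T2, [lower_fill] the other way round; exchanging g and h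
   exchanges them, so their average does not depend on the orientation. *)
Definition fill g h t : R := (upper_fill g h t + lower_fill g h t) / 2.

Lemma upper_fill_le g h t k :
  upper_fill g h t <= Num.max (A1 g h k) (t - A2 g h k).
Proof.
apply: ge_inf; last by exists k.
by exists 0 => _ [l _ <-]; rewrite le_max oprod_ge0.
Qed.

Lemma upper_fill_ge g h t c :
  (forall k, c <= Num.max (A1 g h k) (t - A2 g h k)) -> c <= upper_fill g h t.
Proof.
move=> H; apply: lb_le_inf.
  by exists (Num.max (A1 g h 1%g) (t - A2 g h 1%g)), 1%g.
by move=> _ [k _ <-].
Qed.

Lemma lower_fill_ge g h t k :
  Num.min (A1 g h k) (t - A2 g h k) <= lower_fill g h t.
Proof.
apply: ub_le_sup; last by exists k.
by exists (odist p1 g h) => _ [l _ <-]; rewrite ge_min oprod_le.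
Qed.

Lemma lower_fill_le g h t c :
  (forall k, Num.min (A1 g h k) (t - A2 g h k) <= c) -> lower_fill g h t <= c.
Proof.
move=> H; apply: ge_sup.
  by exists (Num.min (A1 g h 1%g) (t - A2 g h 1%g)), 1%g.
by move=> _ [k _ <-].
Qed.

(** Both [fill] and its complement [t - fill] are nondecreasing, so neither coordinate backtracks
    and the l1 distance is the distance in [T]. *)
Lemma fill_lip g h s t : s <= t -> 0 <= fill g h t - fill g h s <= t - s.
Proof.
move=> st.
have u1 : upper_fill g h s <= upper_fill g h t.
  apply: upper_fill_ge => k; apply: le_trans (upper_fill_le g h s k) _.
  by rewrite ge_max !le_max lexx /= lerB// orbT.
have u2 : upper_fill g h t - (t - s) <= upper_fill g h s.
  apply: upper_fill_ge => k; rewrite lerBlDr.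
  apply: le_trans (upper_fill_le g h t k) _; rewrite ge_max; apply/andP; split.
    have : A1 g h k <= Num.max (A1 g h k) (s - A2 g h k) by rewrite le_max lexx.
    by lra.
  have : s - A2 g h k <= Num.max (A1 g h k) (s - A2 g h k).
    by rewrite le_max lexx orbT.
  by lra.
have l1 : lower_fill g h s <= lower_fill g h t.
  apply: lower_fill_le => k; apply: le_trans (lower_fill_ge g h t k).
  by rewrite le_min !ge_min lexx /= lerB// orbT.
have l2 : lower_fill g h t <= lower_fill g h s + (t - s).
  apply: lower_fill_le => k; rewrite -lerBlDr.
  apply: le_trans (lower_fill_ge g h s k); rewrite le_min; apply/andP; split.
    have : Num.min (A1 g h k) (t - A2 g h k) <= A1 g h k by rewrite ge_min lexx.
    by lra.
  have : Num.min (A1 g h k) (t - A2 g h k) <= t - A2 g h k.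
    by rewrite ge_min lexx orbT.
  by lra.
by rewrite /fill; apply/andP; split; lra.
Qed.

Lemma fill_branch_le g h t k : t <= A g h k ->
  fill g h t <= A1 g h k /\ t - fill g h t <= A2 g h k.
Proof.
rewrite oprodD => tk; split.
  have u := upper_fill_le g h t k; rewrite max_l in u; last by lra.
  have l : lower_fill g h t <= A1 g h k.
    apply: lower_fill_le => l; rewrite ge_min.
    by case: (oprod_chain g h k l) => -[h1 h2]; apply/orP; [right|left]; lra.
  by rewrite /fill; lra.
have l := lower_fill_ge g h t k; rewrite min_r in l; last by lra.
have u : t - A2 g h k <= upper_fill g h t.
  apply: upper_fill_ge => l'; rewrite le_max.
  by case: (oprod_chain g h k l') => -[h1 h2]; apply/orP; [left|right]; lra.
by rewrite /fill; lra.
Qed.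

Lemma fill_ge0 g h t : 0 <= t -> 0 <= fill g h t <= t.
Proof.
move=> t0.
have u0 : 0 <= upper_fill g h t.
  by apply: upper_fill_ge => k; rewrite le_max oprod_ge0.
have := upper_fill_le g h t g; rewrite !oprod_base max_r ?subr0// => u1.
have := lower_fill_ge g h t g; rewrite !oprod_base min_l ?subr0// => l0.
have l1 : lower_fill g h t <= t.
  apply: lower_fill_le => k; rewrite ge_min; apply/orP; right.
  by have := oprod_ge0 p2 g h k; lra.
by rewrite /fill; apply/andP; split; lra.
Qed.

Lemma fill_end g h t : t <= odist p g h ->
  fill g h t <= odist p1 g h /\ t - fill g h t <= odist p2 g h.
Proof. by have := @fill_branch_le g h t h; rewrite !oprod_end. Qed.

Lemma fill_branch g h h' t : t <= A g h h' -> fill g h t = fill g h' t.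
Proof.
have H h1 h2 : t <= A g h1 h2 -> upper_fill g h1 t <= upper_fill g h2 t /\
    lower_fill g h2 t <= lower_fill g h1 t.
  rewrite oprodD => tk; split.
    apply: upper_fill_ge => k; have [[<- <-]|[_ _ c1 c2]] := oprod_branch g h1 h2 k.
      exact: upper_fill_le.
    (* A [k] branching off beyond [h2] bounds no better than [h2] itself. *)
    apply: le_trans (upper_fill_le g h1 t h2) _; rewrite max_l; last by lra.
    by rewrite le_max c1.
  apply: lower_fill_le => k; have [[<- <-]|[_ _ c1 c2]] := oprod_branch g h1 h2 k.
    exact: lower_fill_ge.
  apply: le_trans (lower_fill_ge g h1 t h2); rewrite ge_min !le_min.
  by apply/orP; right; apply/andP; split; lra.
move=> th; have [u1 l1] := H h h' th.
have [u2 l2] : upper_fill g h' t <= upper_fill g h t /\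
    lower_fill g h t <= lower_fill g h' t by apply: H; rewrite oprod_sym.
by rewrite /fill; congr (_ / 2); apply/eqP; rewrite eq_le; apply/andP; split; lra.
Qed.

Lemma fill_flip g h t : fill h g (odist p g h - t) = odist p1 g h - fill g h t.
Proof.
have u : upper_fill h g (odist p g h - t) = odist p1 g h - lower_fill g h t.
  apply/eqP; rewrite eq_le; apply/andP; split.
    rewrite lerBrDr addrC -lerBrDr; apply: lower_fill_le => k.
    have := upper_fill_le h g (odist p g h - t) k.
    rewrite !(oprod_flip _ g h) odistD; move: (upper_fill _ _ _) => u.
    by rewrite le_max ge_min => /orP[] h1; apply/orP; [left|right]; lra.
  apply: upper_fill_ge => k; have := lower_fill_ge g h t k.
  rewrite !(oprod_flip _ g h) odistD; move: (lower_fill _ _ _) => l.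
  by rewrite le_max ge_min => /orP[] h1; apply/orP; [left|right]; lra.
have l : lower_fill h g (odist p g h - t) = odist p1 g h - upper_fill g h t.
  apply/eqP; rewrite eq_le; apply/andP; split.
    apply: lower_fill_le => k; have := upper_fill_le g h t k.
    rewrite !(oprod_flip _ g h) odistD; move: (upper_fill _ _ _) => u'.
    by rewrite le_max ge_min => /orP[] h1; apply/orP; [left|right]; lra.
  rewrite lerBlDr addrC -lerBlDr; apply: upper_fill_ge => k.
  have := lower_fill_ge h g (odist p g h - t) k.
  rewrite !(oprod_flip _ g h) odistD; move: (lower_fill _ _ _) => l'.
  by rewrite le_max ge_min => /orP[] h1; apply/orP; [left|right]; lra.
by rewrite /fill u l; lra.
Qed.

Lemma fill_shift l g h t : fill (l * g)%g (l * h)%g t = fill g h t.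
Proof.
have e k : (l * (l^-1 * k))%g = k by rewrite mulgA mulgV mul1g.
have u : upper_fill (l * g)%g (l * h)%g t = upper_fill g h t.
  apply/eqP; rewrite eq_le; apply/andP; split; apply: upper_fill_ge => k.
    by have := upper_fill_le (l * g)%g (l * h)%g t (l * k)%g; rewrite !oprod_shift.
  have := upper_fill_le g h t (l^-1 * k)%g.
  by rewrite -(oprod_shift p1 l) -(oprod_shift p2 l) e.
have v : lower_fill (l * g)%g (l * h)%g t = lower_fill g h t.
  apply/eqP; rewrite eq_le; apply/andP; split; apply: lower_fill_le => k.
    have := lower_fill_ge g h t (l^-1 * k)%g.
    by rewrite -(oprod_shift p1 l) -(oprod_shift p2 l) e.
  by have := lower_fill_ge (l * g)%g (l * h)%g t (l * k)%g; rewrite !oprod_shift.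
by rewrite /fill u v.
Qed.

End Interpolation.

(** * The hull of the orbit inside the product *)

Section Refinement.
Context {R : realType} {G : groupType}.
Variables (T1 T2 T : Gtree R G) (p1 : T1) (p2 : T2) (p : T).
Hypothesis pD : forall g,
  mdist p (gact g p) = mdist p1 (gact g p1) + mdist p2 (gact g p2).
Implicit Types g h k l : G.

Let T4 : fourpt T := @gtree_fourpt _ _ T.

Notation fill := (fill p1 p2).

(* [z] is the image of [x], a point of [gp, hp], in T1 * T2. *)
Definition placed g h (x : T) (z : T1 * T2) : Prop :=
  [/\ btw (gact g p) x (gact h p),
      btw (gact g p1) z.1 (gact h p1) /\
      mdist (gact g p1) z.1 = fill g h (mdist (gact g p) x) &
      btw (gact g p2) z.2 (gact h p2) /\
      mdist (gact g p2) z.2 = mdist (gact g p) x - fill g h (mdist (gact g p) x)].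

Lemma placed_exists g h x : btw (gact g p) x (gact h p) -> exists z, placed g h x z.
Proof.
move=> gxh; have t0 := mdist_ge0 (gact g p) x.
have tL : mdist (gact g p) x <= odist p g h.
  by rewrite /odist -gxh lerDl mdist_ge0.
have /andP[f0 ft] := fill_ge0 p1 p2 g h t0.
have [f1 f2] := fill_end pD tL.
have [|z1 b1 d1] := @btw_point _ _ (@gtree_geodesic _ _ T1)
  (gact g p1) (gact h p1) (fill g h (mdist (gact g p) x)).
  by rewrite f0.
have [|z2 b2 d2] := @btw_point _ _ (@gtree_geodesic _ _ T2)
  (gact g p2) (gact h p2) (mdist (gact g p) x - fill g h (mdist (gact g p) x)).
  by rewrite subr_ge0 ft.
by exists (z1, z2).
Qed.

Lemma placed_flip g h x z : placed g h x z -> placed h g x z.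
Proof.
move=> [b [b1 d1] [b2 d2]].
have e : mdist (gact h p) x = odist p g h - mdist (gact g p) x.
  by rewrite metric_sym /odist -b addrC addKr.
split; [exact: btw_sym|split; first exact: btw_sym|split; first exact: btw_sym].
  rewrite e (fill_flip pD) -d1 metric_sym /odist -b1; lra.
rewrite e (fill_flip pD) (odistD pD) metric_sym.
have : mdist (gact g p2) z.2 + mdist z.2 (gact h p2) = odist p2 g h := b2.
rewrite d2; lra.
Qed.

Lemma btw_branch (T' : Gtree R G) (q : T') g h h' y :
  btw (gact g q) y (gact h q) -> mdist (gact g q) y <= oprod q g h h' ->
  btw (gact g q) y (gact h' q).
Proof.
move=> b; rewrite /oprod /odist => le.
have [//|b'] := btw_or (@gtree_fourpt _ _ T') (gact h' q) b.
apply: btw_le; move: b b'; rewrite /btw (metric_sym (gact h q) y); lra.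
Qed.

Lemma placed_branch g h h' x z : placed g h x z -> btw (gact g p) x (gact h' p) ->
  placed g h' x z.
Proof.
move=> [b [b1 d1] [b2 d2]] b'.
have t : mdist (gact g p) x <= oprod p g h h'.
  have := metric_triangle (gact h p) x (gact h' p).
  rewrite /oprod /odist (metric_sym _ x) -b -b'; lra.
have [f1 f2] := fill_branch_le pD t; have e := fill_branch pD t.
split=> //; rewrite -e; split=> //.
  by apply: btw_branch b1 _; rewrite d1.
by apply: btw_branch b2 _; rewrite d2.
Qed.

(** The image of a point does not depend on the orbit segment containing it: the ends are exchanged
    one at a time, [btw_or] showing which of them can go first. *)
Lemma placed_move g h g' h' x z : placed g h x z -> btw (gact g' p) x (gact h' p) ->
  placed g' h' x z.
Proof.
move=> pl b'; have [b _ _] := pl.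
have [c|c] := btw_or T4 (gact g' p) b.
  exact: placed_branch (placed_flip (placed_branch pl c)) b'.
exact: placed_branch (placed_flip (placed_branch (placed_flip pl) c)) b'.
Qed.

Lemma placed_isometric_le g h x y z w : placed g h x z -> placed g h y w ->
  mdist (gact g p) x <= mdist (gact g p) y -> l1dist z w = mdist x y.
Proof.
move=> [b [b1 d1] [b2 d2]] [c [c1 e1] [c2 e2]] xy.
have /andP[f1 f2] := fill_lip p1 p2 g h xy.
have k := btw_sorted b c xy.
have k1 : btw (gact g p1) z.1 w.1 by apply: (btw_sorted b1 c1); rewrite d1 e1; lra.
have k2 : btw (gact g p2) z.2 w.2 by apply: (btw_sorted b2 c2); rewrite d2 e2; lra.
move: k k1 k2; rewrite /btw /l1dist d1 d2 e1 e2 => k k1 k2.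
by apply/eqP; rewrite eq_le; apply/andP; split; lra.
Qed.

Lemma l1dist_sym (z w : T1 * T2) : l1dist z w = l1dist w z.
Proof. by rewrite /l1dist metric_sym (metric_sym z.2). Qed.

(** Extend [[x, y]] beyond [x] to an end of the first segment and beyond [y] to an end of the
    second. Distances then need checking on a single segment only. *)
Lemma common_segment g h g' h' x y :
  btw (gact g p) x (gact h p) -> btw (gact g' p) y (gact h' p) ->
  exists a b, btw (gact a p) x (gact b p) /\ btw (gact a p) y (gact b p).
Proof.
move=> bx by_.
have [<-|/eqP xy] := eqVneq x y; first by exists g, h.
have [a ax] : exists a, btw (gact a p) x y.
  by case: (btw_or T4 y bx) => c; [exists g|exists h].
have [b yb] : exists b, btw x y (gact b p).
  by case: (btw_or T4 x by_) => c; [exists g'|exists h']; exact: btw_sym.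
by exists a, b; exact: (btw_chain T4 ax yb xy).
Qed.

Lemma placed_isometric g h g' h' x y z w : placed g h x z -> placed g' h' y w ->
  l1dist z w = mdist x y.
Proof.
move=> pz pw; have [bx _ _] := pz; have [by_ _ _] := pw.
have [a [b [ax ay]]] := common_segment bx by_.
have pz' := placed_move pz ax; have pw' := placed_move pw ay.
have [xy|/ltW xy] := leP (mdist (gact a p) x) (mdist (gact a p) y).
  exact: placed_isometric_le pz' pw' xy.
by rewrite l1dist_sym metric_sym; exact: placed_isometric_le pw' pz' xy.
Qed.

Lemma placed_gact g h k x z : placed g h x z ->
  placed (k * g)%g (k * h)%g (gact k x) (gact k z.1, gact k z.2).
Proof.
move=> [b [b1 d1] [b2 d2]]; rewrite /placed /= !gactM !gact_isometry fill_shift.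
by split; [|split|split]; rewrite // /btw !gact_isometry.
Qed.

Lemma orbit_refinement : compatible T1 T2.
Proof.
pose S := [set z | exists g h x, placed g h x z].
have [||||T' [f1 [f2 [[e1 a1 e2 a2] _ _]]]] := @l1_tree R G T1 T2 S; last first.
  by exists T', f1, f2.
- move=> z w s [g [h [x pz]]] [g' [h' [y pw]]].
  rewrite (placed_isometric pz pw) => s01.
  have [bx _ _] := pz; have [by_ _ _] := pw.
  have [m xmy dm] := btw_point (@gtree_geodesic _ _ T) s01.
  have [a [b [ax ay]]] := common_segment bx by_.
  have mab : btw (gact a p) m (gact b p).
    have [le|/ltW le] := leP (mdist (gact a p) x) (mdist (gact a p) y).
      have h5 := btw_trans (btw_sym (btw_sorted ax ay le)) (btw_sym xmy).
      exact: btw_trans ay (btw_sym h5).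
    have h5 := btw_trans (btw_sym (btw_sorted ay ax le)) xmy.
    exact: btw_trans ax (btw_sym h5).
  have [v pv] := placed_exists mab.
  exists v; split; first by exists a, b, m.
    by rewrite (placed_isometric pz pv).
  by rewrite (placed_isometric pv pw) -xmy dm addrC addKr.
- move=> x y z w [g1 [h1 [x' px]]] [g2 [h2 [y' py]]] [g3 [h3 [z' pz]]] [g4 [h4 [w' pw]]].
  rewrite (placed_isometric px py) (placed_isometric pz pw) (placed_isometric px pz).
  rewrite (placed_isometric py pw) (placed_isometric px pw) (placed_isometric py pz).
  exact: T4.
- move=> k z [g [h [x pz]]]; exists (k * g)%g, (k * h)%g, (gact k x).
  exact: placed_gact.
- have [|z pz] := @placed_exists 1%g 1%g p; first by rewrite gact1; exact: btwxx.
  by exists z, 1%g, 1%g, p.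
Qed.

End Refinement.

Theorem theoremA10 (R : realType) (G : groupType) (T1 T2 : Gtree R G) :
  finitely_generated G ->
  minimal_action T1 -> irreducible_action T1 ->
  minimal_action T2 -> irreducible_action T2 ->
  compatible T1 T2 <->
  length_function
    (fun g : G => (translation_length T1 g + translation_length T2 g)%R).
Proof.
move=> _ _ irr1 _ irr2; split; first exact: compatible_length_function.
move=> [T lT].
have [|p1 [p2 [p pD]]] := @common_base_point R G T1 T2 T _ irr1 irr2.
  by move=> g; rewrite -lT.
exact: orbit_refinement pD.
Qed.
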